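(* Let $\lambda\ge\omega$ and $\kappa\ge 2$ be cardinals with $\kappa\lambda>\omega$, and assume $\mathrm{cf}(\lambda)=\mathrm{cf}(\kappa^{<\lambda})=\omega$. Let $V$ denote the ground model. Then: (a) In every generic extension by $\mathrm{rp}(\mathrm{Col}(\lambda,\kappa))^+$, $|((\kappa^{<\lambda})^+)^V|\le|\mathfrak h^V|$, where $(\kappa^{<\lambda})^+$ is the successor cardinal of $\kappa^{<\lambda}$. (b) If $|\mathfrak h^V|=\omega_1$ in every generic extension by $\mathrm{rp}(\mathrm{Col}(\lambda,\kappa))^+$, then $|((\kappa^{<\lambda})^+)^V|=\omega_1$ in every generic extension by $\mathrm{rp}(\mathrm{Col}(\lambda,\kappa))^+$.
   Context: For a Boolean algebra $\mathbb B$, $\mathbb B^+=\mathbb B\setminus\{0\}$, regarded as a forcing notion. $\mathrm{rp}(\mathbb B)$ is the reduced power $\mathbb B^\omega/\Phi$, where $\Phi$ is the Fréchet filter (cofinite subsets of $\omega$): sequences are identified if they agree on a cofinite set, and $[b]\le[c]$ iff $\{i: b_i\le c_i\}\in\Phi$. For cardinals $\lambda\ge\omega$, $\kappa\ge2$, ${}^{<\lambda}\kappa=\bigcup_{\alpha<\lambda}{}^{\alpha}\kappa$ ($\alpha$ ranging over ordinals), and the collapsing algebra $\mathrm{Col}(\lambda,\kappa)$ is the Boolean completion of the reversed tree $\langle{}^{<\lambda}\kappa,\supseteq\rangle$ (longer functions are stronger). $\kappa^{<\lambda}=|{}^{<\lambda}\kappa|=\sup\{\kappa^\nu:\nu<\lambda\}$.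 $\mathfrak h$ is the distributivity number of $(P(\omega)/\mathrm{Fin})^+$ (least size of a family of dense open subsets with non-dense intersection). *)

(* Defs.v *)
From HB Require Import structures.
From mathcomp Require Import all_boot all_order generic_quotient.
From mathcomp Require Import all_classical.

Set Implicit Arguments.
Unset Strict Implicit.
Unset Printing Implicit Defensive.
Import Order.Theory.

Local Open Scope classical_set_scope.
Local Open Scope order_scope.
Local Open Scope quotient_scope.
Local Open Scope card_scope.

(* The ground model V is the universe of types.  An ordinal of V is
   represented by a well-ordered type, of which it is the order type. *)
Record wellOrder := WellOrder {
  wo_disp : Order.disp_t;
  wo_sort :> orderType wo_disp;
  wo_wf : well_founded (fun x y : wo_sort => x < y)
}.

Lemma nat_wf : well_founded (fun x y : nat => (x < y)%O).
Proof.
by elim/ltn_ind=> n IH; constructor=> m; rewrite ltEnat => /IH.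
Qed.

Definition omega : wellOrder := WellOrder nat_wf.

Definition card_lt (A B : Type) : Prop :=
  [set: A] #<= [set: B] /\ ~ ([set: B] #<= [set: A]).

(* A cardinal is an initial ordinal. *)
Definition is_cardinal (K : wellOrder) : Prop :=
  forall a : K, ~ ([set: K] #<= [set b : K | b < a]).

Definition is_cardinality_of (K : wellOrder) (T : Type) : Prop :=
  is_cardinal K /\ [set: K] #= [set: T].

Definition is_successor_cardinal (N M : wellOrder) : Prop :=
  [/\ is_cardinal N, card_lt M N &
      forall C : wellOrder, is_cardinal C -> card_lt M C ->
        [set: N] #<= [set: C]].

Definition cofinal (W : wellOrder) (A : set W) : Prop :=
  forall x : W, exists2 a, A a & x <= a.

(* cf(W) = |C| *)
Definition has_cofinality (W : wellOrder) (C : Type) : Prop :=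
  (exists2 A : set W, cofinal A & A #= [set: C]) /\
  (forall A : set W, cofinal A -> [set: C] #<= A).

Section Tree.
Variables L K : wellOrder.

(* A pair (a, f) with a < L and f a function from a = {b | b < a} to K. *)
Definition tree := {a : L & {b : L | b < a} -> K}.

(* Reversed inclusion of functions; domains are initial segments. *)
Definition tree_le (s t : tree) : bool :=
  `[< projT1 t <= projT1 s /\
      forall (b : L) (bs : b < projT1 s) (bt : b < projT1 t),
        projT2 s (exist _ b bs) = projT2 t (exist _ b bt) >].

Fact tree_le_refl : reflexive tree_le.
Proof.
move=> s; apply/asboolP; split=> // b bs bt.
by rewrite (bool_irrelevance bs bt).
Qed.

Fact tree_le_anti : antisymmetric tree_le.
Proof.
move=> [a f] [c g] /andP[/asboolP[/= ca fg] /asboolP[/= ac _]].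
have e : a = c by apply/le_anti/andP.
case: c / e g ca fg ac => g _ fg _; congr existT.
by apply/funext=> -[b ba]; rewrite (fg b ba ba).
Qed.

Fact tree_le_trans : transitive tree_le.
Proof.
move=> t s u /asboolP[ts st] /asboolP[ut tu]; apply/asboolP.
split=> [|b bs bu]; first exact: le_trans ut ts.
have bt : b < projT1 t by exact: lt_le_trans bu ut.
by rewrite (st b bs bt).
Qed.

HB.instance Definition _ := gen_eqMixin tree.
HB.instance Definition _ := gen_choiceMixin tree.
HB.instance Definition _ := Order.Le_isPOrder.Build (wo_disp L) tree
  tree_le_refl tree_le_anti tree_le_trans.

End Tree.

Section RegularOpen.
Context {d : Order.disp_t} {T : porderType d}.
Implicit Types U W : set T.

(* RO T below is the Boolean completion of T, realised as its regular open
   algebra.  In the topology whose open sets are the down-closed sets, [perp U]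
   is the interior of the complement of U, and for U open it is the complement
   of the closure of U.  Hence U is regular open iff perp (perp U) = U. *)
Definition perp U : set T := [set p | forall q, q <= p -> ~ U q].
Definition regular_open U : Prop := perp (perp U) = U.

Definition down_closed U : Prop := forall p q, q <= p -> U p -> U q.

Lemma perp_down U : down_closed (perp U).
Proof. by move=> p q qp Up r rq; apply: Up; exact: le_trans rq qp. Qed.

Lemma perp_anti U W : U `<=` W -> perp W `<=` perp U.
Proof. by move=> UW p Wp q qp /UW; exact: Wp. Qed.

Lemma sub_perp2 U : down_closed U -> U `<=` perp (perp U).
Proof. by move=> Uo p Up q qp /(_ q (lexx q)); apply; exact: Uo Up. Qed.

Lemma regular_down U : regular_open U -> down_closed U.
Proof. by move=> <-; exact: perp_down. Qed.

Lemma perp_regular U : down_closed U -> regular_open (perp U).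
Proof.
move=> Uo; apply/seteqP; split; last exact/sub_perp2/perp_down.
exact/perp_anti/sub_perp2.
Qed.

Lemma setI_down U W : down_closed U -> down_closed W -> down_closed (U `&` W)%classic.
Proof. by move=> Uo Wo p q qp [Up Wp]; split; [exact: Uo Up|exact: Wo Wp]. Qed.

Lemma setI_regular U W :
  regular_open U -> regular_open W -> regular_open (U `&` W)%classic.
Proof.
move=> Ur Wr; apply/seteqP; split; last first.
  exact: sub_perp2 (setI_down (regular_down Ur) (regular_down Wr)).
by move=> p UWp; split; [rewrite -Ur|rewrite -Wr];
  apply: perp_anti UWp; apply: perp_anti => q [].
Qed.

Lemma set0_regular : regular_open set0.
Proof.
by apply/seteqP; split=> // p /(_ p (lexx p)); case=> q _.
Qed.

End RegularOpen.

Record RO (d : Order.disp_t) (T : porderType d) :=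
  MkRO { ro_set : set T; _ : `[< regular_open ro_set >] }.

Section RegularOpenAlgebra.
Variables (d : Order.disp_t) (T : porderType d).

HB.instance Definition _ := [isSub for @ro_set d T].
HB.instance Definition _ := [Choice of RO T by <:].

Implicit Types x y z : RO T.

Lemma roP x : regular_open (ro_set x).
Proof. by case: x => U /= /asboolP. Qed.

Lemma ro_down x : down_closed (ro_set x).
Proof. exact: regular_down (roP x). Qed.

Lemma ro_inj x y : ro_set x = ro_set y -> x = y.
Proof. exact: val_inj. Qed.

Definition ro_le x y : bool := `[< ro_set x `<=` ro_set y >].

Definition ro_meet x y : RO T := MkRO (asboolT (setI_regular (roP x) (roP y))).

Definition ro_compl x : RO T := MkRO (asboolT (perp_regular (@ro_down x))).

Definition ro_join x y : RO T := ro_compl (ro_meet (ro_compl x) (ro_compl y)).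

Definition ro_bot : RO T := MkRO (asboolT set0_regular).

Definition ro_top : RO T := ro_compl ro_bot.

Fact ro_le_refl : reflexive ro_le.
Proof. by move=> x; apply/asboolP. Qed.

Fact ro_le_anti : antisymmetric ro_le.
Proof.
by move=> x y /andP[/asboolP xy /asboolP yx]; apply/ro_inj/seteqP; split.
Qed.

Fact ro_le_trans : transitive ro_le.
Proof.
by move=> y x z /asboolP xy /asboolP yz; apply/asboolP; exact: subset_trans xy yz.
Qed.

HB.instance Definition _ := Order.Le_isPOrder.Build d (RO T)
  ro_le_refl ro_le_anti ro_le_trans.

Fact ro_meetC : commutative ro_meet.
Proof. by move=> x y; apply: ro_inj => /=; rewrite setIC. Qed.

Fact ro_joinC : commutative ro_join.
Proof. by move=> x y; rewrite /ro_join ro_meetC. Qed.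

Fact ro_meetA : associative ro_meet.
Proof. by move=> x y z; apply: ro_inj => /=; rewrite setIA. Qed.

Fact ro_complK : involutive ro_compl.
Proof. by move=> x; apply: ro_inj => /=; exact: roP. Qed.

Fact ro_joinA : associative ro_join.
Proof. by move=> x y z; rewrite /ro_join !ro_complK ro_meetA. Qed.

Fact ro_joinKI y x : ro_meet x (ro_join x y) = x.
Proof.
apply: ro_inj; apply/seteqP; split=> [p []//|p xp]; split=> // q qp [/= + _].
by apply: (sub_perp2 (@ro_down x)) qp.
Qed.

Fact ro_meetKU y x : ro_join x (ro_meet x y) = x.
Proof.
apply: ro_inj => /=; rewrite -[RHS]roP; congr perp.
apply/seteqP; split=> [p []//|p xp]; split=> //.
by apply: perp_anti xp => q [].
Qed.

Fact ro_leEmeet x y : (x <= y) = (ro_meet x y == x).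
Proof.
apply/asboolP/eqP=> [/setIidPl xy|<-]; first exact: ro_inj.
by move=> p [].
Qed.

Fact ro_meetUl : left_distributive ro_meet ro_join.
Proof.
move=> x y z; apply: ro_inj; apply/seteqP; split=> p.
  move=> [/= xyp zp] q qp [/= xzq yzq]; apply: (xyp q qp).
  have zq : ro_set z q by exact: ro_down qp zp.
  by split=> r rq h; [apply: (xzq r rq)|apply: (yzq r rq)]; split=> //;
    exact: ro_down rq zq.
move=> /= h; split; [|rewrite -roP]; apply: perp_anti h.
  by move=> q [xq yq]; split; [apply: perp_anti xq|apply: perp_anti yq] => r [].
by move=> q zq; split; apply: perp_anti zq => r [].
Qed.

HB.instance Definition _ := Order.POrder_Meet_isDistrLattice.Build d (RO T)
  ro_meetC ro_joinC ro_meetA ro_joinA ro_joinKI ro_meetKU ro_leEmeet ro_meetUl.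

Fact ro_le0x x : ro_bot <= x.
Proof. exact/asboolP. Qed.

Fact ro_lex1 x : x <= ro_top.
Proof. by apply/asboolP => p _ q _. Qed.

HB.instance Definition _ := Order.hasBottom.Build d (RO T) ro_le0x.
HB.instance Definition _ := Order.hasTop.Build d (RO T) ro_lex1.

Fact ro_meetxC x : x `&` ro_compl x = \bot.
Proof.
by apply: ro_inj; apply/seteqP; split=> // p [xp /(_ p (lexx p))]; apply.
Qed.

Fact ro_joinxC x : x `|` ro_compl x = \top.
Proof.
have -> : x `|` ro_compl x = ro_compl (x `&` ro_compl x).
  by rewrite /Order.join /= /ro_join ro_complK ro_meetC.
by rewrite ro_meetxC.
Qed.

HB.instance Definition _ := Order.TBDistrLattice_hasComplement.Build d (RO T)
  ro_joinxC ro_meetxC.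

End RegularOpenAlgebra.

Definition Col (L K : wellOrder) : ctbDistrLatticeType (wo_disp L) :=
  RO (tree L K).

Section Positive.
Context {d : Order.disp_t}.
Variable B : bPOrderType d.

Definition pos := {x : B | x != \bot}.

HB.instance Definition _ := SubChoice.on pos.
HB.instance Definition _ := [SubChoice_isSubPOrder of pos by <: with d].

End Positive.

Section ReducedPower.
Context {d : Order.disp_t}.
Variable B : ctbDistrLatticeType d.

Definition eqmod (b c : nat -> B) : bool := `[< \forall i \near \oo, b i = c i >].

Fact eqmod_equiv : equiv_class_of eqmod.
Proof.
split=> [b|b c|c b e /asboolP bc /asboolP ce].
- by apply/asboolP; near=> i.
- by apply/asbool_equiv_eq; split; apply: filterS => i ->.
- by apply/asboolP; apply: filterS2 bc ce => i -> ->.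
Unshelve. all: by end_near. Qed.

Canonical eqmod_rel := EquivRelPack eqmod_equiv.

Definition rp := {eq_quot eqmod_rel}.

HB.instance Definition _ := Choice.on rp.

(* repr picks a representative of a class; see rp_leE. *)
Definition rp_le (x y : rp) : bool :=
  `[< \forall i \near \oo, repr x i <= repr y i >].

Lemma rp_reprE (b : nat -> B) : \forall i \near \oo, repr (\pi_rp b) i = b i.
Proof.
have /eqP : \pi_rp (repr (\pi_rp b)) = \pi_rp b by rewrite reprK.
by rewrite piE => /asboolP.
Qed.

Lemma rp_leE (b c : nat -> B) :
  rp_le (\pi_rp b) (\pi_rp c) <-> \forall i \near \oo, b i <= c i.
Proof.
split=> [/asboolP|] bc; last apply/asboolP; near=> i.
  by rewrite -(near (rp_reprE b) i) // -(near (rp_reprE c) i) //; near: i.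
by rewrite (near (rp_reprE b) i) // (near (rp_reprE c) i) //; near: i.
Unshelve. all: by end_near. Qed.

Fact rp_le_refl : reflexive rp_le.
Proof. by move=> x; apply/asboolP; near=> i. Unshelve. all: by end_near. Qed.

Fact rp_le_anti : antisymmetric rp_le.
Proof.
move=> x y /andP[/asboolP xy /asboolP yx].
rewrite -[x]reprK -[y]reprK; apply/eqP; rewrite piE; apply/asboolP.
by apply: filterS2 xy yx => i xy yx; apply/le_anti/andP.
Qed.

Fact rp_le_trans : transitive rp_le.
Proof.
move=> y x z /asboolP xy /asboolP yz; apply/asboolP.
by apply: filterS2 xy yz => i; exact: le_trans.
Qed.

HB.instance Definition _ := Order.Le_isPOrder.Build d rp
  rp_le_refl rp_le_anti rp_le_trans.

Definition rp_bot : rp := \pi_rp (fun=> \bot).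

Fact rp_le0x x : rp_bot <= x.
Proof.
by rewrite -[x]reprK; apply/rp_leE; near=> i; exact: le0x.
Unshelve. all: by end_near. Qed.

HB.instance Definition _ := Order.hasBottom.Build d rp rp_le0x.

End ReducedPower.

Section Distributivity.
Context {d : Order.disp_t}.
Variable P : porderType d.

Definition dense_below (D : set P) (p : P) : Prop :=
  forall q, q <= p -> exists2 r, r <= q & D r.

Definition dense_in (D : set P) : Prop := forall p, exists2 r, r <= p & D r.

Definition open_dense (D : set P) : Prop := down_closed D /\ dense_in D.

Definition nondistributive_family (F : set (set P)) : Prop :=
  F `<=` open_dense /\ ~ dense_in (\bigcap_(D in F) D).

Definition is_distributivity_number (H : wellOrder) : Prop :=
  [/\ is_cardinal H,
      exists2 F, nondistributive_family F & F #= [set: H] &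
      forall F, nondistributive_family F -> [set: H] #<= F].

End Distributivity.

(* (P(omega)/Fin)^+: subsets of omega are given by their characteristic
   functions nat -> bool, and two of these agree on a cofinite set iff the
   symmetric difference of the subsets is finite. *)
Definition PomegaFin_pos := pos (rp bool).

Definition is_h (H : wellOrder) : Prop :=
  is_distributivity_number PomegaFin_pos H.

(* P-names: a name is a set of pairs (name, condition), given as an indexed
   family. *)
Inductive name (P : Type) : Type :=
  Name (I : Type) (el : I -> name P) (cond : I -> P).

Section Forcing.
Context {d : Order.disp_t}.
Variable P : porderType d.
Local Notation name := (name P).

(* A sentence of the forcing language is identified with the set of the
   conditions that force it, given by the usual recursive clauses. *)
Definition sentence := set P.
Implicit Types (A B : sentence) (x y z : name).

Fixpoint forces_eq x y : sentence :=
  let: Name _ s c := x in let: Name _ t e := y in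
  [set p |
    (forall i, dense_below [set q | q <= c i ->
       exists2 j, q <= e j & forces_eq (s i) (t j) q] p) /\
    (forall j, dense_below [set q | q <= e j ->
       exists2 i, q <= c i & forces_eq (s i) (t j) q] p)].

Definition forces_in x y : sentence :=
  let: Name _ t e := y in
  [set p | dense_below [set q |
     exists2 j, q <= e j & forces_eq x (t j) q] p].

Definition forces_and A B : sentence := (A `&` B)%classic.
Definition forces_not A : sentence := [set p | forall q, q <= p -> ~ A q].
Definition forces_ex (A : name -> sentence) : sentence :=
  [set p | dense_below [set q | exists x, A x q] p].

Definition forces_or A B := forces_not (forces_and (forces_not A) (forces_not B)).
Definition forces_imp A B := forces_not (forces_and A (forces_not B)).
Definition forces_iff A B := forces_and (forces_imp A B) (forces_imp B A).
Definition forces_all (A : name -> sentence) :=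
  forces_not (forces_ex (fun x => forces_not (A x))).

(* The sentence holds in every generic extension of V by P. *)
Definition holds_in_extensions A : Prop := forall p : P, A p.

(* The canonical name of (the von Neumann ordinal isomorphic to) a
   well-order.  Every element is paired with every condition, so no largest
   condition is needed. *)
Definition check_elt (W : wellOrder) : W -> name :=
  Fix (@wo_wf W) (fun=> name) (fun a rec =>
    Name (fun z : {b : W | b < a} * P => rec (sval z.1) (svalP z.1)) snd).

Definition check (W : wellOrder) : name :=
  Name (fun z : W * P => check_elt z.1) snd.

Lemma check_eltE (W : wellOrder) (a : W) : check_elt a =
  Name (fun z : {b : W | b < a} * P => check_elt (sval z.1)) snd.
Proof.
rewrite {1}/check_elt Fix_eq // => b f g fg.
by congr Name; apply/funext=> z; exact: fg.
Qed.

End Forcing.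

Notation "x \inF y" := (forces_in x y) (at level 70).
Notation "x =F y" := (forces_eq x y) (at level 70).
Notation "A /\F B" := (forces_and A B) (at level 80, right associativity).
Notation "A \/F B" := (forces_or A B) (at level 85, right associativity).
Notation "~F A" := (forces_not A) (at level 75, right associativity).
Notation "A ->F B" := (forces_imp A B) (at level 90, right associativity, B at level 200).
Notation "A <->F B" := (forces_iff A B) (at level 95).
Notation "'allF' x , A" := (forces_all (fun x => A))
  (at level 200, x name, A at level 200).
Notation "'exF' x , A" := (forces_ex (fun x => A))
  (at level 200, x name, A at level 200).

Section Formulas.
Context {d : Order.disp_t} {P : porderType d}.
Implicit Types x y z u v w f : name P.

Definition is_upair z x y : sentence P :=
  allF w, w \inF z <->F (w =F x \/F w =F y).

(* Kuratowski pair *)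
Definition is_pair z x y : sentence P :=
  exF u, exF v, is_upair u x x /\F is_upair v x y /\F is_upair z u v.

Definition maps f x y : sentence P := exF z, is_pair z x y /\F z \inF f.

Definition is_function f x y : sentence P :=
  (allF z, z \inF f ->F
     exF u, exF v, u \inF x /\F v \inF y /\F is_pair z u v) /\F
  (allF u, u \inF x ->F exF v, maps f u v) /\F
  (allF u, allF v, allF w, maps f u v ->F maps f u w ->F v =F w).

Definition is_injective f : sentence P :=
  allF u, allF v, allF w, maps f u w ->F maps f v w ->F u =F v.

Definition is_onto f y : sentence P :=
  allF v, v \inF y ->F exF u, maps f u v.

Definition le_cardF x y : sentence P :=
  exF f, is_function f x y /\F is_injective f.

Definition eq_cardF x y : sentence P :=
  exF f, is_function f x y /\F is_injective f /\F is_onto f y.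

Definition is_transitive x : sentence P :=
  allF y, y \inF x ->F allF z, z \inF y ->F z \inF x.

Definition is_ordinal x : sentence P :=
  is_transitive x /\F allF y, y \inF x ->F is_transitive y.

(* omega is the same in V and in its extensions. *)
Definition is_countable x : sentence P := le_cardF x (check P omega).

(* w is the least uncountable ordinal of the extension *)
Definition is_omega1 w : sentence P :=
  is_ordinal w /\F ~F is_countable w /\F
  allF v, v \inF w ->F is_countable v.

Definition card_omega1 x : sentence P := exF w, is_omega1 w /\F eq_cardF x w.

End Formulas.

(* Main.v *)
From HB Require Import structures.
From Stdlib Require Import Wellfounded.
Require Import Defs.
From mathcomp Require Import all_boot all_order generic_quotient.
From mathcomp Require Import all_classical wochoice.

Set Implicit Arguments.
Unset Strict Implicit.
Unset Printing Implicit Defensive.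
Import Order.Theory.

Local Open Scope classical_set_scope.
Local Open Scope card_scope.

(* Part (a).  Fix functions g_b (b < nu) from omega to the tree that differ
   pairwise at all but finitely many places; they exist because mu, the size of
   the tree, has cofinality omega and nu is its successor.  There are also
   (P(omega)/Fin)^+-names f_xi (xi < h) of functions on omega such that every
   function on an infinite set is forced, below some infinite subset, to agree
   with some f_xi: a Cantor tree built from a witness of non-distributivity
   provides enough incompatible conditions at a single level xi to list all
   continuum many requirements.  A condition q of rp(Col(lambda, kappa))^+ puts
   (xi, b) in a generic relation when it decides f_xi along its support and, for
   almost all i in its support, q_i codes the node g_b(i) in a segment of the
   branch starting at the height l_(f_xi(i)), where (l_n) is cofinal in lambda.
   The b so related to a given xi is unique, as two of the g_b cannot agree
   infinitely often; and every condition can be extended to relate a given b to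
   some xi.  Sending b to the least such xi is an injection from nu to h.

   Part (b).  The forcing is sigma-closed, so omega_1 is preserved and is the
   only ordinal of the extension that can be omega_1.  As omega_1 embeds in nu
   in the ground model, and nu embeds in h, hence in omega_1, in the extension,
   the Cantor-Bernstein argument gives a bijection. *)

(** * Forced statements *)

Section ForcingLogic.
Context {d : Order.disp_t} {P : porderType d}.
Implicit Types (A B : sentence P) (x y z u v w f : name P) (p q r : P).

(** These are exactly the regular open sets of [P], the truth values of the forcing language. A
    stable goal may be proved after passing to stronger conditions. *)
Definition stable A : Prop :=
  down_closed A /\ forall p, dense_below A p -> A p.

Lemma stable_perp A : down_closed A -> stable (~F A).
Proof.
move=> Ad; split=> [p q qp Ap r rq|p Ap q qp Aq].
  exact: Ap (le_trans rq qp).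
by have [r rq /(_ r (lexx r))] := Ap q qp; apply; exact: Ad Aq.
Qed.

Lemma down_not A : down_closed (~F A).
Proof. by move=> p q qp Ap r rq; exact: Ap (le_trans rq qp). Qed.

Lemma dense_below_down A : down_closed (dense_below A).
Proof. by move=> p q qp Ap r rq; exact: Ap (le_trans rq qp). Qed.

Lemma down_and A B : down_closed A -> down_closed B -> down_closed (A /\F B).
Proof. exact: setI_down. Qed.

Lemma stable_and A B : stable A -> stable B -> stable (A /\F B).
Proof.
move=> [Ad As] [Bd Bs]; split; first exact: down_and.
by move=> p AB; split; [apply: As|apply: Bs] => q /AB[r rq []]; exists r.
Qed.

Lemma stable_dense_below A : stable (dense_below A).
Proof.
split=> [|p Ap q qp]; first exact: dense_below_down.
by have [r rq /(_ r (lexx r))[s sr As]] := Ap q qp; exists s => //; exact: le_trans rq.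
Qed.

Lemma stable_ex (A : name P -> sentence P) : stable (forces_ex A).
Proof. exact: stable_dense_below. Qed.

Lemma stable_all (A : name P -> sentence P) : stable (forces_all A).
Proof. by apply: stable_perp; case: (stable_ex (fun x => ~F A x)). Qed.

Lemma stable_or A B : stable (A \/F B).
Proof. by apply: stable_perp; apply: down_and; exact: down_not. Qed.

Lemma stable_imp A B : down_closed A -> stable (A ->F B).
Proof. by move=> Ad; apply: stable_perp; apply: down_and => //; exact: down_not. Qed.

Lemma stable_down A : stable A -> down_closed A.
Proof. by case. Qed.

Lemma stable_iff A B : stable A -> stable B -> stable (A <->F B).
Proof. by move=> /stable_down Ad /stable_down Bd; apply: stable_and; exact: stable_imp. Qed.

Lemma stableP A p : stable A -> (forall q, q <= p -> exists2 r, r <= q & A r)%O -> A p.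
Proof. by move=> [_]; apply. Qed.

(** Implication is coded by negation and conjunction. Reading it directly needs [B] stable: a
    condition with no extension in [B] would force the negation of [B]. *)
Lemma forces_impP A B p : down_closed A -> stable B ->
  (A ->F B) p <-> forall q, (q <= p)%O -> A q -> B q.
Proof.
move=> Ad [_ Bs]; split=> [AB q qp Aq|AB q qp [Aq nB]].
  apply: Bs => r rq; apply/not_exists2P => nB.
  apply: (AB r (le_trans rq qp)); split; first exact: Ad Aq.
  by move=> s sr Bs; have := nB s; case.
by apply: (nB q (lexx q)); exact: AB.
Qed.

Lemma forces_iffP A B p : stable A -> stable B ->
  (A <->F B) p <-> forall q, (q <= p)%O -> (A q <-> B q).
Proof.
move=> As Bs; have [[Ad _] [Bd _]] := (As, Bs); split.
  by move=> [/(forces_impP _ Ad Bs) AB /(forces_impP _ Bd As) BA] q qp; split;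
    [exact: AB|exact: BA].
by move=> AB; split; apply/forces_impP => // q qp; case: (AB q qp).
Qed.

Lemma forces_allP (A : name P -> sentence P) p : (forall x, stable (A x)) ->
  forces_all A p <-> forall x, A x p.
Proof.
move=> As; split=> [Ap x|Ap q qp]; last first.
  move=> /(_ q (lexx q))[r rq [x /(_ r (lexx r))]]; apply.
  exact: (stable_down (As x)) (le_trans rq qp) (Ap x).
apply: (stableP (As x)) => q qp; apply/not_exists2P => nA.
apply: (Ap q qp) => r rq; exists r => //; exists x => s sr Axs.
by have := nA s; case=> //; apply; exact: le_trans rq.
Qed.

Lemma forces_orP A B p : (A \/F B) p <-> dense_below [set q | A q \/ B q] p.
Proof.
split=> [AB q qp|AB q qp [nA nB]].
  apply/not_exists2P => nAB; apply: (AB q qp).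
  by split=> r rq ?; have := nAB r; case=> //; apply; [left|right].
by have [r rq [Ar|Br]] := AB q qp; [exact: (nA r)|exact: (nB r)].
Qed.

(** The main elimination rule: for a stable goal, what holds only densely below [p] may be used as
    if it held. *)
Lemma dense_elim A B p : stable B -> dense_below A p ->
  (forall q, (q <= p)%O -> A q -> B q) -> B p.
Proof.
move=> [_ Bs] Ap AB; apply: Bs => q /[dup] qp /Ap[r rq Ar]; exists r => //.
exact: AB (le_trans rq qp) Ar.
Qed.

Lemma forces_exE (A : name P -> sentence P) B p : stable B -> forces_ex A p ->
  (forall x q, (q <= p)%O -> A x q -> B q) -> B p.
Proof. by move=> Bs /(dense_elim Bs) Ap AB; apply: Ap => q qp [x]; exact: AB. Qed.

Lemma forces_orE A B C p : stable C -> (A \/F B) p ->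
  (forall q, (q <= p)%O -> A q -> C q) -> (forall q, (q <= p)%O -> B q -> C q) -> C p.
Proof.
move=> Cs /forces_orP/(dense_elim Cs) ABp AC BC; apply: ABp => q qp [].
  exact: AC.
exact: BC.
Qed.

Lemma forces_orl A B p : down_closed A -> A p -> (A \/F B) p.
Proof. by move=> Ad Ap; apply/forces_orP => q qp; exists q => //; left; exact: Ad Ap. Qed.

Lemma forces_orr A B p : down_closed B -> B p -> (A \/F B) p.
Proof. by move=> Ad Ap; apply/forces_orP => q qp; exists q => //; right; exact: Ad Ap. Qed.

Lemma forces_exI (A : name P -> sentence P) x p : down_closed (A x) -> A x p ->
  forces_ex A p.
Proof. by move=> Ad Ap q qp; exists q => //; exists x; exact: Ad Ap. Qed.

(** The implication under [dense_below] can be moved outside, because a condition that is not below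
    [c i] satisfies it vacuously. *)
Lemma forces_eqP x y p : (x =F y) p <->
  let: Name _ s c := x in let: Name _ t e := y in
  (forall i q, q <= p -> q <= c i -> exists2 r, r <= q &
     exists2 j, r <= e j & (s i =F t j) r)%O /\
  (forall j q, q <= p -> q <= e j -> exists2 r, r <= q &
     exists2 i, r <= c i & (s i =F t j) r)%O.
Proof.
case: x y => [I s c] [J t e] /=; split=> -[H1 H2]; split.
- move=> i q qp qc; have [r rq /(_ (le_trans rq qc))[j re E]] := H1 i q qp.
  by exists r => //; exists j.
- move=> i q qp qc; have [r rq /(_ (le_trans rq qc))[j re E]] := H2 i q qp.
  by exists r => //; exists j.
- move=> i q qp; have [qc|nqc] := boolP (q <= c i)%O.
    by have [r rq ?] := H1 i q qp qc; exists r.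
  by exists q => //= qc; rewrite qc in nqc.
- move=> i q qp; have [qc|nqc] := boolP (q <= e i)%O.
    by have [r rq ?] := H2 i q qp qc; exists r.
  by exists q => //= qc; rewrite qc in nqc.
Qed.

Lemma stable_eq x y : stable (x =F y).
Proof.
case: x y => [I s c] [J t e]; split=> [p q qp|p].
  by move=> /forces_eqP[H1 H2]; apply/forces_eqP; split=> i r rq;
    [apply: H1|apply: H2]; exact: le_trans qp.
move=> H; apply/forces_eqP; split=> i q qp qc; have [r rq /forces_eqP[H1 H2]] := H q qp.
  by have [r' ? ?] := H1 i r (lexx r) (le_trans rq qc); exists r' => //; exact: le_trans rq.
by have [r' ? ?] := H2 i r (lexx r) (le_trans rq qc); exists r' => //; exact: le_trans rq.
Qed.

Lemma stable_in x y : stable (x \inF y).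
Proof. by case: y => [J t e]; exact: stable_dense_below. Qed.

Lemma forces_refl x p : (x =F x) p.
Proof.
elim: x p => I s IH c p; apply/forces_eqP.
by split=> i q qp qc; exists q => //; exists i.
Qed.

Lemma forces_sym x y p : (x =F y) p -> (y =F x) p.
Proof.
elim: x y p => I s IH c [J t e] p /forces_eqP[H1 H2]; apply/forces_eqP; split=> i q qp qc.
  by have [r rq [j rj /IH]] := H2 i q qp qc; exists r => //; exists j.
by have [r rq [j rj /IH]] := H1 i q qp qc; exists r => //; exists j.
Qed.

Lemma forces_trans x y z p : (x =F y) p -> (y =F z) p -> (x =F z) p.
Proof.
elim: x y z p => I s IH c [J t e] [K u g] p /forces_eqP[H1 H2] /forces_eqP[H3 H4].
apply/forces_eqP; split=> i q qp qc.
  have [r rq [j rj E]] := H1 i q qp qc.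
  have [r' rr' [k r'k E']] := H3 j r (le_trans rq qp) rj.
  exists r'; first exact: le_trans rq.
  by exists k => //; apply: IH E'; exact: (stable_down (stable_eq _ _)) rr' E.
have [r rq [j rj E]] := H4 i q qp qc.
have [r' rr' [k r'k E']] := H2 j r (le_trans rq qp) rj.
exists r'; first exact: le_trans rq.
exists k => //; apply: IH E' _; exact: (stable_down (stable_eq _ _)) rr' E.
Qed.

Lemma in_congl x y z p : (x =F y) p -> (x \inF z) p -> (y \inF z) p.
Proof.
case: z => [J t e] xy xz q qp; have [r rq [j rj E]] := xz q qp.
exists r => //; exists j => //; apply: forces_trans E; apply: forces_sym.
exact: (stable_down (stable_eq _ _)) (le_trans rq qp) xy.
Qed.

Lemma in_congr x y z p : (x =F y) p -> (z \inF x) p -> (z \inF y) p.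
Proof.
case: x y => [I s c] [J t e] /forces_eqP[H1 _] zx q qp.
have [r rq [i ri E]] := zx q qp.
have [r' rr' [j rj E']] := H1 i r (le_trans rq qp) ri.
exists r'; first exact: le_trans rq.
by exists j => //; apply: forces_trans E'; exact: (stable_down (stable_eq _ _)) rr' E.
Qed.

Lemma forces_ext x y p :
  (forall z q, (q <= p)%O -> (z \inF x) q <-> (z \inF y) q) -> (x =F y) p.
Proof.
case: x y => [I s c] [J t e] H; apply/forces_eqP; split=> i q qp qc.
  have : (s i \inF Name s c) q by move=> r rq; exists r => //; exists i;
    [exact: le_trans rq qc|exact: forces_refl].
  by move=> /H => /(_ qp)/(_ q (lexx q)).
have : (t i \inF Name t e) q by move=> r rq; exists r => //; exists i;
    [exact: le_trans rq qc|exact: forces_refl].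
move=> /H => /(_ qp)/(_ q (lexx q))[r rq [j rj E]].
by exists r => //; exists j => //; exact: forces_sym.
Qed.

Lemma stable_upair z x y : stable (is_upair z x y).
Proof. exact: stable_all. Qed.

Lemma stable_pair z x y : stable (is_pair z x y).
Proof. exact: stable_ex. Qed.

Lemma stable_maps f x y : stable (maps f x y).
Proof. exact: stable_ex. Qed.

End ForcingLogic.

#[local] Hint Resolve stable_and stable_ex stable_all stable_or stable_eq stable_in
  stable_upair stable_pair stable_maps stable_dense_below stable_down stable_imp
  stable_iff : stable.

(** * Unordered and Kuratowski pairs in the extension *)

Section Pairs.
Context {d : Order.disp_t} {P : porderType d}.
Implicit Types (x y z u v w f : name P) (p q r : P).

Lemma forces_mono A p q : @stable _ P A -> (q <= p)%O -> A p -> A q.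
Proof. by move=> /stable_down Ad; exact: Ad. Qed.

Lemma upairP z x y p : is_upair z x y p <-> forall w q, (q <= p)%O ->
  (w \inF z) q <-> (w =F x \/F w =F y) q.
Proof.
have Hs w : stable (w \inF z <->F w =F x \/F w =F y) by auto with stable.
split=> [/(forces_allP p Hs) H w q qp|H].
  by move/forces_iffP: (H w); apply; auto with stable.
apply/(forces_allP p Hs) => w; apply/forces_iffP; auto with stable => q qp; exact: H.
Qed.

Lemma upair_l z x y p : is_upair z x y p -> (x \inF z) p.
Proof.
by move=> /upairP/(_ x p (lexx p))[_]; apply; apply: forces_orl; auto with stable;
  exact: forces_refl.
Qed.

Lemma upair_r z x y p : is_upair z x y p -> (y \inF z) p.
Proof.
by move=> /upairP/(_ y p (lexx p))[_]; apply; apply: forces_orr; auto with stable;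
  exact: forces_refl.
Qed.

Lemma upair_elim C z x y w p : stable C -> is_upair z x y p -> (w \inF z) p ->
  (forall q, (q <= p)%O -> (w =F x) q -> C q) ->
  (forall q, (q <= p)%O -> (w =F y) q -> C q) -> C p.
Proof.
by move=> Cs /upairP/(_ w p (lexx p))[zw _] /zw {}zw; exact: (forces_orE Cs zw).
Qed.

Lemma upair_single z x w p : is_upair z x x p -> (w \inF z) p -> (w =F x) p.
Proof. by move=> zx wz; apply: (upair_elim _ zx wz) => //; exact: stable_eq. Qed.

Lemma upair_congr z x y x' y' p : (x =F x') p -> (y =F y') p ->
  is_upair z x y p -> is_upair z x' y' p.
Proof.
move=> xx yy /upairP H; apply/upairP => w q qp; rewrite H //.
have {}xx : (x =F x') q by apply: forces_mono xx; auto with stable.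
have {}yy : (y =F y') q by apply: forces_mono yy; auto with stable.
split=> H'; apply: (forces_orE _ H'); auto with stable => r rq E.
- by apply: forces_orl; auto with stable; apply: forces_trans E _; apply: forces_mono xx;
  auto with stable.
- by apply: forces_orr; auto with stable; apply: forces_trans E _; apply: forces_mono yy;
  auto with stable.
- by apply: forces_orl; auto with stable; apply: forces_trans E _; apply: forces_sym;
  apply: forces_mono xx; auto with stable.
- by apply: forces_orr; auto with stable; apply: forces_trans E _; apply: forces_sym;
  apply: forces_mono yy; auto with stable.
Qed.

Lemma pair_congr z x y x' y' p : (x =F x') p -> (y =F y') p ->
  is_pair z x y p -> is_pair z x' y' p.
Proof.
move=> xx yy zxy; apply: (forces_exE _ zxy) => [|u q qp]; first exact: stable_ex.
move=> H; apply: (forces_exE _ H) => [|v r rq [ux [vxy zuv]]]; first exact: stable_ex.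
have rp := le_trans rq qp.
have {}xx : (x =F x') r by apply: forces_mono xx; auto with stable.
have {}yy : (y =F y') r by apply: forces_mono yy; auto with stable.
apply: (forces_exI (x := u)); first by auto with stable.
apply: (forces_exI (x := v)); first by auto with stable.
by split; [exact: upair_congr ux|split=> //; exact: upair_congr vxy].
Qed.

Lemma maps_congr f x y x' y' p : (x =F x') p -> (y =F y') p ->
  maps f x y p -> maps f x' y' p.
Proof.
move=> xx yy fxy; apply: (forces_exE _ fxy) => [|z q qp [zxy zf]]; first exact: stable_ex.
apply: (forces_exI (x := z)); first by auto with stable.
by split=> //; apply: pair_congr zxy; [apply: forces_mono xx|apply: forces_mono yy];
  auto with stable.
Qed.

Lemma upair_in_congr z z' x y p : (z =F z') p -> is_upair z x y p -> is_upair z' x y p.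
Proof.
move=> zz /upairP H; apply/upairP => w q qp; rewrite -H //.
have {}zz : (z =F z') q by apply: forces_mono zz; auto with stable.
by split=> ?; [apply: in_congr (forces_sym zz) _|apply: in_congr zz _].
Qed.

(** Kuratowski's argument, run below a condition that has fixed the inner sets [u], [v], [u'], [v']
    of both pairs. *)
Lemma pair_inj z z' x y x' y' p : (z =F z') p ->
  is_pair z x y p -> is_pair z' x' y' p -> ((x =F x') /\F (y =F y')) p.
Proof.
move=> zz zxy zxy'; have Gs w w' : stable ((x =F w) /\F (y =F w')) by auto with stable.
apply: (forces_exE _ zxy) => // u q qp H; apply: (forces_exE _ H) => // v r rq [ux [vxy zuv]].
have {rq}rp := le_trans rq qp; have {}zxy' := forces_mono (stable_pair _ _ _) rp zxy'.
apply: (forces_exE _ zxy') => // u' s sr H';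
  apply: (forces_exE _ H') => // v' t ts [ux' [vxy' zuv']].
have {ts}tr := le_trans ts sr.
have {}zz := forces_mono (stable_eq _ _) (le_trans tr rp) zz.
have {}ux := forces_mono (stable_upair _ _ _) tr ux.
have {}vxy := forces_mono (stable_upair _ _ _) tr vxy.
have {}zuv := upair_in_congr zz (forces_mono (stable_upair _ _ _) tr zuv).
clear - zuv zuv' ux ux' vxy vxy'.
(* [u'] is [u] or [v]; either one contains [x], and [u'] is the singleton of [x']. *)
have xx : (x =F x') t.
  apply: (upair_elim _ zuv (upair_l zuv')); auto with stable => q qt E;
    apply: (upair_single (forces_mono (stable_upair _ _ _) qt ux')).
    exact: in_congr (forces_sym E) (upair_l (forces_mono (stable_upair _ _ _) qt ux)).
  exact: in_congr (forces_sym E) (upair_l (forces_mono (stable_upair _ _ _) qt vxy)).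
split=> //.
(* [v] is [u'] or [v']. In the first case [y] and then [y'] are equal to [x']. In the second [y] is
   [y'] or [x'], and in the latter case [y'], being an element of [v], is [x] or [y]. *)
apply: (upair_elim _ zuv' (upair_r zuv)); auto with stable => q qt E;
  move: zuv zuv' ux ux' vxy vxy' xx.
  move=> /(forces_mono (stable_upair _ _ _) qt) zuv /(forces_mono (stable_upair _ _ _) qt)
    zuv'.
  move=> /(forces_mono (stable_upair _ _ _) qt) ux /(forces_mono (stable_upair _ _ _) qt) ux'.
  move=> /(forces_mono (stable_upair _ _ _) qt) vxy /(forces_mono (stable_upair _ _ _) qt)
    vxy'.
  move=> /(forces_mono (stable_eq _ _) qt) xx {qt}.
  have yx : (y =F x') q by apply: (upair_single ux'); apply: in_congr E _; exact: upair_r vxy.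
  apply: (upair_elim _ zuv (upair_r zuv')); auto with stable => r rq E'.
    have := upair_single (forces_mono (stable_upair _ _ _) rq ux).
    move=> /(_ y') y'x; apply: forces_trans (forces_mono (stable_eq _ _) rq yx) _.
    apply: forces_trans (forces_sym (forces_mono (stable_eq _ _) rq xx)) _;
      apply: forces_sym; apply: y'x.
    by apply: in_congr E' _; apply: upair_r; apply: forces_mono vxy'; auto with stable.
  apply: forces_trans (forces_mono (stable_eq _ _) rq yx) _; apply: forces_sym.
  apply: (upair_single (forces_mono (stable_upair _ _ _) rq ux')).
  apply: in_congr (forces_mono (stable_eq _ _) rq E) _; apply: in_congr E' _.
  by apply: upair_r; apply: forces_mono vxy'; auto with stable.
move=> _ _ _ _.
move=> /(forces_mono (stable_upair _ _ _) qt) vxy /(forces_mono (stable_upair _ _ _) qt) vxy'.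
move=> /(forces_mono (stable_eq _ _) qt) xx {qt}.
apply: (upair_elim _ vxy'  (in_congr E (upair_r vxy))); auto with stable => r rq yx.
have E' := forces_mono (stable_eq _ _) rq E.
apply: (upair_elim _ (forces_mono (stable_upair _ _ _) rq vxy)); auto with stable.
- apply: in_congr (forces_sym E') (upair_r (forces_mono (stable_upair _ _ _) rq vxy')).
- move=> s sr y'x; apply: forces_trans (forces_mono (stable_eq _ _) sr yx) _;
  apply: forces_sym.
  by apply: forces_trans y'x _; exact: forces_mono (stable_eq _ _) (le_trans sr rq) xx.
- by move=> s sr /forces_sym.
Qed.

Definition upN x y : name P := Name (fun z : bool * P => if z.1 then x else y) snd.

Lemma is_upair_upN x y p : is_upair (upN x y) x y p.
Proof.
apply/upairP => w q qp; rewrite forces_orP; split=> H r rq; have [s sr] := H r rq.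
  by case=> [[[] c] /= tc E]; exists s => //; [left|right].
by case=> E; exists s => //; [exists (true, s)|exists (false, s)].
Qed.

Definition pairN x y : name P := upN (upN x x) (upN x y).

Lemma is_pair_pairN x y p : is_pair (pairN x y) x y p.
Proof.
apply: (forces_exI (x := upN x x)); first by auto with stable.
apply: (forces_exI (x := upN x y)); first by auto with stable.
by split; [|split]; exact: is_upair_upN.
Qed.

End Pairs.

(** * Names of relations between ground model sets *)

Section Functions.
Context {d : Order.disp_t} {P : porderType d}.
Implicit Types (x y z u v w f : name P) (p q r : P).

Lemma is_functionP f x y p : is_function f x y p <->
  [/\ forall z q, (q <= p)%O -> (z \inF f) q ->
        (exF u, exF v, u \inF x /\F v \inF y /\F is_pair z u v) q,
      forall u q, (q <= p)%O -> (u \inF x) q -> (exF v, maps f u v) q &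
      forall u v w q, (q <= p)%O -> maps f u v q -> maps f u w q -> (v =F w) q].
Proof.
split=> [[/forces_allP H1 [/forces_allP H2 /forces_allP H3]]|[H1 H2 H3]]; split.
- move=> z q qp zf; move: (H1 ltac:(auto with stable) z) => /forces_impP.
  by apply; auto with stable.
- move=> z q qp zf; move: (H2 ltac:(auto with stable) z) => /forces_impP.
  by apply; auto with stable.
- move=> u v w q qp uv uw; move: (H3 ltac:(auto with stable) u) => /forces_allP.
  move=> /(_ ltac:(auto with stable) v)/forces_allP.
  move=> /(_ ltac:(auto with stable) w)/forces_impP.
  move=> /(_ ltac:(auto with stable) ltac:(auto with stable) q qp uv)/forces_impP.
  by apply; auto with stable.
- apply/forces_allP => [|z]; auto with stable.
  by apply/forces_impP => [||q]; auto with stable.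
- split.
    apply/forces_allP => [|z]; auto with stable.
    by apply/forces_impP => [||q]; auto with stable.
  apply/forces_allP => [|u]; auto with stable.
  apply/forces_allP => [|v]; auto with stable.
  apply/forces_allP => [|w]; auto with stable.
  apply/forces_impP => [||q qp uv]; auto with stable.
  apply/forces_impP => [||r rq uw]; auto with stable.
  apply: (H3 u) uw; first exact: le_trans rq qp.
  exact: (forces_mono (stable_maps _ _ _)) rq uv.
Qed.

Lemma is_injectiveP f p : is_injective f p <->
  forall u v w q, (q <= p)%O -> maps f u w q -> maps f v w q -> (u =F v) q.
Proof.
split=> [/forces_allP H u v w q qp uw vw|H].
  move: (H ltac:(auto with stable) u) => /forces_allP.
  move=> /(_ ltac:(auto with stable) v)/forces_allP.
  move=> /(_ ltac:(auto with stable) w)/forces_impP.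
  move=> /(_ ltac:(auto with stable) ltac:(auto with stable) q qp uw)/forces_impP.
  by apply; auto with stable.
apply/forces_allP => [|u]; auto with stable.
apply/forces_allP => [|v]; auto with stable.
apply/forces_allP => [|w]; auto with stable.
apply/forces_impP => [||q qp uv]; auto with stable.
apply/forces_impP => [||r rq uw]; auto with stable.
apply: (H u v w) uw; first exact: le_trans rq qp.
exact: (forces_mono (stable_maps _ _ _)) rq uv.
Qed.

Lemma is_ontoP f y p : is_onto f y p <->
  forall v q, (q <= p)%O -> (v \inF y) q -> (exF u, maps f u v) q.
Proof.
split=> [/forces_allP H v q qp vy|H].
  move: (H ltac:(auto with stable) v) => /forces_impP.
  by apply; auto with stable.
apply/forces_allP => [|v]; auto with stable.
by apply/forces_impP => [||q]; auto with stable.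
Qed.

Lemma stable_function f x y : stable (is_function f x y).
Proof. by apply: stable_and; [|apply: stable_and]; auto with stable. Qed.

Lemma stable_injective f : stable (is_injective f).
Proof. exact: stable_all. Qed.

Lemma stable_onto f y : stable (is_onto f y).
Proof. exact: stable_all. Qed.

(** Every element is present at every condition. [check P W] and, by [check_elt_hat], its initial
    segments are of this form, so both are treated together. *)
Definition hat (A : Type) (nm : A -> name P) : name P :=
  Name (fun z : A * P => nm z.1) snd.

Lemma in_hatP A (nm : A -> name P) u p :
  (u \inF hat nm) p <-> dense_below [set q | exists a, (u =F nm a) q] p.
Proof.
split=> H q qp; have [r rq] := H q qp.
  by case=> -[a c] /= _ E; exists r => //; exists a.
by case=> a E; exists r => //; exists (a, r).
Qed.

Lemma in_hat A (nm : A -> name P) a p : (nm a \inF hat nm) p.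
Proof. by apply/in_hatP => q _; exists q => //; exists a; exact: forces_refl. Qed.

Definition separated A (nm : A -> name P) : Prop :=
  forall a b p, (nm a =F nm b) p -> a = b.

(* [F a b] is the set of conditions forcing a generic relation to hold
   between a and b. *)
Record forced_injection A B (F : A -> B -> set P) p : Prop := ForcedInjection {
  finj_down : forall a b, down_closed (F a b);
  finj_fun : forall a b b' q, F a b q -> F a b' q -> b = b';
  finj_inj : forall a a' b q, F a b q -> F a' b q -> a = a';
  finj_total : forall a, dense_below [set q | exists b, F a b q] p }.

Definition forced_onto A B (F : A -> B -> set P) p : Prop :=
  forall b, dense_below [set q | exists a, F a b q] p.

Section Rel.
Variables (A B : Type) (nmA : A -> name P) (nmB : B -> name P).
Hypotheses (sepA : separated nmA) (sepB : separated nmB).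

Definition rel_name (F : A -> B -> set P) : name P :=
  Name (fun z : {z : A * B * P | F z.1.1 z.1.2 z.2} =>
    pairN (nmA (sval z).1.1) (nmB (sval z).1.2)) (fun c => (sval c).2).

Lemma in_rel_name F z p : (z \inF rel_name F) p ->
  (forall a b, down_closed (F a b)) ->
  dense_below [set q | exists a b, F a b q /\ (z =F pairN (nmA a) (nmB b)) q] p.
Proof.
move=> H Fd q qp; have [r rq [[[[a b] c] /= Fc] rc E]] := H q qp.
by exists r => //; exists a, b; split=> //; exact: Fd Fc.
Qed.

Lemma maps_rel_name F a b p : F a b p -> maps (rel_name F) (nmA a) (nmB b) p.
Proof.
move=> Fp; apply: (forces_exI (x := pairN (nmA a) (nmB b))); first by auto with stable.
split; first exact: is_pair_pairN.
move=> q qp; exists q => //.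
by exists (exist (fun z : A * B * P => F z.1.1 z.1.2 z.2) (a, b, p) Fp) => //;
  exact: forces_refl.
Qed.

Lemma maps_rel_nameE F u v p : (forall a b, down_closed (F a b)) ->
  maps (rel_name F) u v p -> dense_below
    [set q | exists a b, [/\ F a b q, (u =F nmA a) q & (v =F nmB b) q]] p.
Proof.
move=> Fd H; apply: (forces_exE _ H) => [|z q qp [zuv /in_rel_name/(_ Fd)]];
  first exact: stable_dense_below.
move=> /dense_elim; apply => [|r rq [a [b [Fr E]]]]; first exact: stable_dense_below.
move=> s sr; exists s => //; exists a, b.
have [] := pair_inj E (forces_mono (stable_pair _ _ _) rq zuv) (@is_pair_pairN _ _ _ _ _).
by split; [exact: Fd Fr|apply: forces_mono sr _ ..]; auto with stable.
Qed.

(** Separation of [nmA] gives functionality and separation of [nmB] injectivity: names forced equal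
    then come from the same index, to which the clauses on [F] apply. *)
Lemma forced_injection_name (F : A -> B -> set P) p : forced_injection F p ->
  (is_function (rel_name F) (hat nmA) (hat nmB) /\F is_injective (rel_name F)) p.
Proof.
case=> Fd Ff Fi Ft; split.
  apply/is_functionP; split.
  - move=> z q qp /in_rel_name/(_ Fd)/dense_elim; apply; auto with stable.
    move=> r rq [a [b [Fr E]]].
    apply: (forces_exI (x := nmA a)); auto with stable.
    apply: (forces_exI (x := nmB b)); auto with stable.
    split; first exact: in_hat.
    split; first exact: in_hat.
    apply: (forces_exI (x := upN (nmA a) (nmA a))); auto with stable.
    apply: (forces_exI (x := upN (nmA a) (nmB b))); auto with stable.
    split; first exact: is_upair_upN.
    split; first exact: is_upair_upN.
    apply: upair_in_congr (forces_sym E) _; exact: is_upair_upN.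
  - move=> u q qp /in_hatP/dense_elim; apply; auto with stable.
    move=> r rq [a E] s sr.
    have [t ts [b Ft']] := Ft a s (le_trans sr (le_trans rq qp)).
    exists t => //; exists (nmB b); apply: maps_congr (maps_rel_name Ft').
      by apply: forces_sym; apply: forces_mono (le_trans ts sr) E; auto with stable.
    exact: forces_refl.
  - move=> u v w q qp /(maps_rel_nameE Fd) uv /(maps_rel_nameE Fd) uw.
    apply: (dense_elim _ uv); auto with stable => r rq [a [b [Fab ua vb]]].
    apply: (dense_elim _ (dense_below_down rq uw));
      auto with stable => s sr [a' [b' [Fab' ua' vb']]].
    move: (forces_mono (stable_eq _ _) sr ua) (forces_mono (stable_eq _ _) sr vb) => {}ua {}vb.
    have aa := sepA (forces_trans (forces_sym ua) ua'); rewrite -aa {aa} in Fab'.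
    have bb := Ff _ _ _ _ (Fd _ _ _ _ sr Fab) Fab'; rewrite -bb in vb'.
    exact: forces_trans vb (forces_sym vb').
apply/is_injectiveP => u w v q qp /(maps_rel_nameE Fd) uv /(maps_rel_nameE Fd) uw.
apply: (dense_elim _ uv); auto with stable => r rq [a [b [Fab ua vb]]].
apply: (dense_elim _ (dense_below_down rq uw));
  auto with stable => s sr [a' [b' [Fab' ua' vb']]].
move: (forces_mono (stable_eq _ _) sr ua) (forces_mono (stable_eq _ _) sr vb) => {}ua {}vb.
have bb := sepB (forces_trans (forces_sym vb) vb'); rewrite -bb {bb} in Fab'.
have aa := Fi _ _ _ _ (Fd _ _ _ _ sr Fab) Fab'; rewrite -aa in ua'.
exact: forces_trans ua (forces_sym ua').
Qed.

Lemma forced_injection_le (F : A -> B -> set P) p : forced_injection F p -> le_cardF (hat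
  nmA) (hat nmB) p.
Proof.
by move=> /forced_injection_name H q qp; exists q => //; exists (rel_name F);
  apply: forces_mono qp H; apply: stable_and; [exact: stable_function|exact: stable_injective].
Qed.

Lemma forced_bijection_eq (F : A -> B -> set P) p : forced_injection F p -> forced_onto F p ->
  eq_cardF (hat nmA) (hat nmB) p.
Proof.
move=> /forced_injection_name [H1 H2] Fo q qp; exists q => //; exists (rel_name F).
apply: forces_mono qp _.
  apply: stable_and; first exact: stable_function.
  by apply: stable_and; [exact: stable_injective|exact: stable_onto].
split=> //; split=> //; apply/is_ontoP => v {}q qp /in_hatP/dense_elim; apply;
  auto with stable.
move=> r rq [b E] s sr.
have [t ts [a Fab]] := Fo b s (le_trans sr (le_trans rq qp)).
exists t => //; exists (nmA a); apply: maps_congr (maps_rel_name Fab);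
  first exact: forces_refl.
by apply: forces_sym; apply: forces_mono (le_trans ts sr) E; auto with stable.
Qed.

(** Cut down to the conditions below [p], because [f] is an injective function only there, while the
    clauses of [forced_injection] other than totality range over all conditions. *)
Definition maps_below f p a b : set P := [set q | (q <= p)%O /\ maps f (nmA a) (nmB b) q].

Lemma forced_injection_maps f p :
  is_function f (hat nmA) (hat nmB) p -> is_injective f p ->
  forced_injection (maps_below f p) p.
Proof.
move=> /is_functionP[H1 H2 H3] /is_injectiveP H4; split.
- move=> a b q r rq [qp /(forces_mono (stable_maps _ _ _) rq)]; split=> //.
  exact: le_trans rq qp.
- by move=> a b b' q [qp abq] [_ abq']; apply: (sepB (p := q)); exact: (H3 (nmA a)).
- by move=> a a' b q [qp abq] [_ abq']; apply: (sepA (p := q)); exact: (H4 _ _ (nmB b)).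
(* The value of [f] at [nmA a] is at first just some name [v]. Decoding the pair puts [v] in
   [hat nmB], and a stronger condition decides its index. *)
- move=> a; apply: (forces_exE _ (H2 _ _ (lexx p) (@in_hat _ _ _ _))) => [|v q qp av];
  auto with stable.
  apply: (forces_exE _ av) => [|z r rq [zav zf]]; auto with stable.
  apply: (forces_exE _ (H1 _ _ (le_trans rq qp) zf)) => [|u' s sr H]; auto with stable.
  apply: (forces_exE _ H) => [|v' t ts [_ [v'B zuv]]]; auto with stable.
  have tr := le_trans ts sr; have tq := le_trans tr rq.
  have [_ vv] := pair_inj (forces_refl z t) (forces_mono (stable_pair _ _ _) tr zav) zuv.
  move/in_hatP: v'B => /dense_elim; apply; auto with stable => o ot [b vb] o' oo.
  exists o' => //; exists b; split; first exact: le_trans oo (le_trans ot (le_trans tq qp)).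
  apply: (forces_mono (stable_maps _ _ _) oo);
    apply: maps_congr (forces_mono (stable_maps _ _ _) (le_trans ot tq) av).
    exact: forces_refl.
  by apply: forces_trans vb; apply: forces_mono ot vv; auto with stable.
Qed.

End Rel.

Lemma check_elt_hat (W : wellOrder) (a : W) : check_elt P a =
  hat (fun b : {b : W | (b < a)%O} => check_elt P (sval b)).
Proof. exact: check_eltE. Qed.

Lemma check_elt_in (W : wellOrder) (a b : W) p : (b < a)%O -> (check_elt P b \inF check_elt
  P a) p.
Proof.
by move=> ba; rewrite (check_elt_hat a); exact: (@in_hat _ _ (exist (fun b =>
  (b < a)%O) b ba) p).
Qed.

Lemma in_check_eltP (W : wellOrder) (a : W) x p : (x \inF check_elt P a) p <->
  dense_below [set q | exists2 b, (b < a)%O & (x =F check_elt P b) q] p.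
Proof.
rewrite check_elt_hat in_hatP; split=> H q qp; have [r rq] := H q qp.
  by case=> -[b ba] E; exists r => //; exists b.
by case=> b ba E; exists r => //; exists (exist _ b ba).
Qed.

(** If two distinct indices were identified, the smaller one would be forced to be an element of
    itself, hence equal to the name of a still smaller index, against the induction hypothesis. *)
Lemma check_elt_separated (W : wellOrder) : separated (@check_elt _ P W).
Proof.
move=> a; elim/(well_founded_ind (@wo_wf W)): a => a IH b p E.
case: (ltgtP a b) => // ab; exfalso.
  have := in_congr (forces_sym E) (check_elt_in p ab).
  move=> /in_check_eltP/(_ p (lexx p))[q _ [c ca /forces_sym E']].
  by have := IH c ca _ _ E' => e; rewrite e ltxx in ca.
have := in_congr E (check_elt_in p ab).
move=> /in_check_eltP/(_ p (lexx p))[q _ [c cb E']].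
by have := IH b ab _ _ E' => e; rewrite e ltxx in cb.
Qed.

Lemma check_elt_separated_below (W : wellOrder) (a : W) :
  separated (fun b : {b : W | (b < a)%O} => check_elt P (sval b)).
Proof. by move=> b c p /check_elt_separated; case: b c => [b ?] [c ?] /= e;
  exact: eq_exist. Qed.

Lemma injection_le_card A B (nmA : A -> name P) (nmB : B -> name P) (g : A -> B) p :
  separated nmA -> separated nmB -> injective g -> le_cardF (hat nmA) (hat nmB) p.
Proof.
move=> sA sB gi; apply: (forced_injection_le sA sB (F := fun a b => [set q | g a = b])).
split=> [a b q r|a b b' q /= <-|a a' b q /= <- /gi|a q qp] //.
by exists q => //; exists (g a).
Qed.

End Functions.

(** * Cardinalities *)

Section Cardinals.

Lemma sval_inj T (A : T -> Prop) : injective (@sval T A).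
Proof. by case=> x Ax [y Ay] /= xy; exact: eq_exist. Qed.

Lemma card_leEP T U (A : set T) (B : set U) :
  A #<= B <-> exists f : {x | A x} -> {y | B y}, injective f.
Proof.
split=> [/card_leP[f]|[f fi]].
  exists (fun x => let y := f (SigSub (mem_set (svalP x))) in exist _ (sval y) (set_mem
    (svalP y))).
  move=> x y /(congr1 sval) /= /sval_inj e; apply: sval_inj.
  by have /(congr1 val) := 'inj_f (mem_set I) (mem_set I) e.
apply/card_leP/injfunPex.
exists (fun x => let y := f (exist _ (sval x) (set_mem (svalP x))) in SigSub (mem_set
  (svalP y))) => //.
by move=> x y _ _ /(congr1 val) /= /sval_inj/fi/(congr1 sval) /= e; apply: val_inj.
Qed.

Lemma card_leTP T U (B : set U) :
  [set: T] #<= B <-> exists2 f : T -> U, injective f & forall x, B (f x).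
Proof.
rewrite card_leEP; split=> [[f fi]|[f fi fB]].
  exists (fun x => sval (f (exist _ x I))) => [x y /sval_inj/fi/(congr1 sval)//|x];
    exact: svalP.
by exists (fun x => exist _ _ (fB (sval x))) => x y /(congr1 sval)/= /fi/sval_inj.
Qed.

Lemma card_leTTP T U : [set: T] #<= [set: U] <-> exists f : T -> U, injective f.
Proof. by rewrite card_leTP; split=> -[f]; exists f. Qed.

Lemma card_le_sigP T U (A : set T) : A #<= [set: U] <-> [set: {x | A x}] #<= [set: U].
Proof.
rewrite card_leEP card_leTTP; split=> -[f fi].
  by exists (fun x => sval (f x)) => x y /sval_inj/fi.
by exists (fun x => exist _ (f x) I) => x y /(congr1 sval)/= /fi.
Qed.

Variables (W : wellOrder) (a : W).

Definition seg := {x : W | (x < a)%O}.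
HB.instance Definition _ := SubChoice.on seg.
HB.instance Definition _ := [SubChoice_isSubOrder of seg by <: with wo_disp W].

Lemma seg_wf : well_founded (fun x y : seg => (x < y)%O).
Proof.
move=> x; elim/(well_founded_ind (@wo_wf W)): (val x) {-2}x (erefl (val x)) => b IH {}x xb.
by constructor=> y yx; apply: (IH (val y)) => //; rewrite -xb.
Qed.

Definition seg_wo := WellOrder seg_wf.

End Cardinals.

(** Cut [W] at the least element whose initial segment does not embed in [M], if there is one. For
    countable [M] this produces omega_1 inside [W]. *)
Lemma least_large (W : wellOrder) (M : Type) : ~ ([set: W] #<= [set: M]) ->
  exists W' : wellOrder, [/\ ~ ([set: W'] #<= [set: M]),
    forall b : W', [set c | (c < b)%O] #<= [set: M] & [set: W'] #<= [set: W]].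
Proof.
move=> Wl; have [Ws|] := pselect (forall b : W, [set c | (c < b)%O] #<= [set: M]).
  by exists W.
move=> /existsNP[a]; elim/(well_founded_ind (@wo_wf W)): a => a IH al.
have [[b [ba /IH]]|small] := pselect (exists b, (b < a)%O /\ ~ ([set c | (c < b)%O] #<=
  [set: M])).
  exact.
exists (seg_wo a); split.
- by move=> H; apply: al; apply/card_le_sigP.
- move=> b; apply: contrapT => bl; apply: small; exists (val b); split; first exact: (svalP b).
  move=> sb; apply: bl; apply: card_le_trans sb; apply/card_leEP.
  exists (fun x => exist (fun c => (c < val b)%O) (val (sval x)) (svalP x)) => x y.
  by move=> /(congr1 sval) /= e; apply: sval_inj; apply: val_inj.
- by apply/card_leTTP; exists val; exact: val_inj.
Qed.

(** * Ordinals of the extension *)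

Section Ordinals.
Context {d : Order.disp_t} {P : porderType d}.
Implicit Types (x y z u v w f : name P) (p q r : P).

Lemma is_transitiveP x p : is_transitive x p <->
  forall y z q, (q <= p)%O -> (y \inF x) q -> (z \inF y) q -> (z \inF x) q.
Proof.
split=> [/forces_allP H y z q qp yx zy|H].
  move: (H ltac:(auto with stable) y) => /forces_impP.
  move=> /(_ ltac:(auto with stable) ltac:(auto with stable) q qp yx)/forces_allP.
  move=> /(_ ltac:(auto with stable) z)/forces_impP.
  by apply; auto with stable.
apply/forces_allP => [|y]; auto with stable.
apply/forces_impP => [||q qp yx]; auto with stable.
apply/forces_allP => [|z]; auto with stable.
apply/forces_impP => [||r rq zy]; auto with stable.
apply: (H y z) zy; first exact: le_trans rq qp.
exact: (forces_mono (stable_in _ _)) rq yx.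
Qed.

Lemma stable_transitive x : stable (is_transitive x).
Proof. exact: stable_all. Qed.

Lemma stable_ordinal x : stable (is_ordinal x).
Proof. by apply: stable_and; exact: stable_all. Qed.

Lemma is_ordinalP x p : is_ordinal x p <->
  is_transitive x p /\ forall y q, (q <= p)%O -> (y \inF x) q -> is_transitive y q.
Proof.
split=> -[H1 H2]; split=> //.
  move=> y q qp yx; move/forces_allP: H2 => /(_ ltac:(auto with stable) y)/forces_impP.
  by apply; auto with stable; exact: stable_transitive.
apply/forces_allP => [|y]; auto with stable.
by apply/forces_impP => [||q]; auto with stable; exact: stable_transitive.
Qed.

Lemma ordinal_in x y p : is_ordinal x p -> (y \inF x) p -> is_ordinal y p.
Proof.
move=> /is_ordinalP[/is_transitiveP xt yt] yx; apply/is_ordinalP.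
split=> [|z q qp zy]; first exact: yt yx.
apply: yt => //; apply: (xt y) => //; exact: (forces_mono (stable_in _ _)) qp yx.
Qed.

Lemma transitive_congr x y p : (x =F y) p -> is_transitive x p -> is_transitive y p.
Proof.
move=> xy /is_transitiveP H; apply/is_transitiveP => z t q qp zy tz.
move: (forces_mono (stable_eq _ _) qp xy) => {}xy.
by apply: (in_congr xy); apply: (H z) => //; exact: in_congr (forces_sym xy) zy.
Qed.

Lemma check_elt_transitive (W : wellOrder) (a : W) p : is_transitive (check_elt P a) p.
Proof.
apply/is_transitiveP => y z q qp /in_check_eltP ya zy.
apply: (dense_elim _ ya); auto with stable => r rq [b ba yb].
have /in_check_eltP zb := in_congr yb (forces_mono (stable_in _ _) rq zy).
apply: (dense_elim _ zb); auto with stable => s sr [c cb zc].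
apply: in_congl (forces_sym zc) _; exact: check_elt_in (lt_trans cb ba).
Qed.

Lemma check_ordinal (W : wellOrder) p : is_ordinal (check P W) p.
Proof.
apply/is_ordinalP; split.
  apply/is_transitiveP => y z q qp /in_hatP ya zy.
  apply: (dense_elim _ ya); auto with stable => r rq [b yb].
  have /in_check_eltP zb := in_congr yb (forces_mono (stable_in _ _) rq zy).
  apply: (dense_elim _ zb); auto with stable => s sr [c cb zc].
  apply: in_congl (forces_sym zc) _; exact: in_hat.
move=> y q qp /in_hatP ya.
apply: (dense_elim (stable_transitive y) ya) => r rq [b yb].
apply: transitive_congr (forces_sym yb) _; exact: check_elt_transitive.
Qed.

(* Foundation in the extension. *)
Lemma forces_minimal (phi : name P -> set P) p :
  (forall x y q, (x =F y) q -> phi x q -> phi y q) ->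
  (forall x, down_closed (phi x)) ->
  forall x q, (q <= p)%O -> phi x q ->
  exists y r, [/\ (r <= p)%O, phi y r & forall z s, (s <= r)%O -> (z \inF y) s -> ~ phi z s].
Proof.
move=> phic phid; elim=> I el IH c q qp phix.
have [[z [s [sq zx phiz]]]|nz] :=
    pselect (exists z s, [/\ (s <= q)%O, (z \inF Name el c) s & phi z s]).
  have [t ts [i ti E]] := zx s (lexx s).
  apply: (IH i t); first exact: le_trans ts (le_trans sq qp).
  by apply: phic E _; exact: phid ts phiz.
exists (Name el c), q; split=> // z s sq zx phiz; apply: nz; by exists z, s.
Qed.

(** Only a dense set of conditions decides which of the three cases holds. *)
Definition comparable w x p : Prop :=
  dense_below [set q | [\/ (x \inF w) q, (w =F x) q | (w \inF x) q]] p.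

(** If no extension of [q] puts [w] in [X], then [X] is included in [w]. Either [w] has no further
    elements and equals [X], or a minimal element of [w] outside [X] is [X] itself, so that [X]
    belongs to [w]. *)
Lemma comparable_hat A (nm : A -> name P) :
  (forall a w p, is_ordinal w p -> comparable w (nm a) p) ->
  (forall p, is_transitive (hat nm) p) ->
  forall w p, is_ordinal w p -> comparable w (hat nm) p.
Proof.
move=> nmc Xt; set X := hat nm => w p wo q qp.
move: (forces_mono (stable_ordinal _) qp wo) => {}wo.
have [[r rq wX]|nwX] := pselect (exists2 r, (r <= q)%O & (w \inF X) r).
  by exists r => //; exact: Or33.
have nmw a r : (r <= q)%O -> (nm a \inF w) r.
  move=> rq; apply: (dense_elim _ (nmc a w r (forces_mono (stable_ordinal _) rq wo)));
    auto with stable.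
  move=> s sr [//|E|E]; case: nwX; exists s; rewrite ?(le_trans sr rq) //.
    by apply: in_congl (forces_sym E) _; exact: in_hat.
  by have /is_transitiveP := Xt s; apply; [exact: lexx|exact: in_hat|exact: E].
have Xw z r : (r <= q)%O -> (z \inF X) r -> (z \inF w) r.
  move=> rq /in_hatP zX; apply: (dense_elim _ zX); auto with stable => s sr [a E].
  by apply: in_congl (forces_sym E) _; apply: nmw; exact: le_trans sr rq.
pose phi z r := (z \inF w) r /\ forall s, (s <= r)%O -> ~ (z \inF X) s.
have [[z [r [rq phiz]]]|nphi] := pselect (exists z r, (r <= q)%O /\ phi z r); last first.
  exists q => //; apply: Or32; apply: forces_ext => z r rq; split; last exact: Xw.
  move=> zw; apply: (stableP (stable_in _ _)) => s sr; apply: contrapT => nzX; apply: nphi.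
  exists z, s; split; first exact: le_trans sr rq.
  split; first exact: (forces_mono (stable_in _ _)) sr zw.
  by move=> t ts zX; apply: nzX; exists t.
have [| |{z r rq phiz} x [r [rq [xw xX] xmin]]] := @forces_minimal phi q _ _ z r rq phiz.
- move=> x y s xy [xw nxX]; split; first exact: in_congl xy xw.
  move=> t ts yX; apply: (nxX t ts); apply: in_congl _ yX.
  by apply: forces_sym; apply: forces_mono ts xy; auto with stable.
- move=> x s t ts [xw nxX]; split; first exact: (forces_mono (stable_in _ _)) ts xw.
  by move=> o ot; apply: nxX; exact: le_trans ot ts.
move: (forces_mono (stable_ordinal _) rq wo) => {}wo.
have xo := ordinal_in wo xw.
exists r => //; apply: Or31; apply: (in_congl _ xw); apply: forces_ext => z s sr;
  split=> [zx|zX].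
  have zw : (z \inF w) s.
    have [/is_transitiveP wt _] := wo; apply: (wt x) => //.
    exact: (forces_mono (stable_in _ _)) sr xw.
  apply: (stableP (stable_in _ _)) => t ts; apply: contrapT => nzX.
  apply: (xmin z t (le_trans ts sr)); first exact: (forces_mono (stable_in _ _)) ts zx.
  split=> [|o ot zX]; first exact: (forces_mono (stable_in _ _)) ts zw.
  by apply: nzX; exists o.
move/in_hatP: zX => /dense_elim; apply; auto with stable => t ts [a E].
apply: in_congl (forces_sym E) _.
have tr := le_trans ts sr.
(* Comparison is now applied to the ordinal [x]: were [x] equal to [nm a] or an element of it, it
   would lie in the transitive set [X]. *)
apply: (dense_elim _ (nmc a x t (forces_mono (stable_ordinal _) tr xo))); auto with stable.
move=> o ot [//|E'|E']; case: (xX o (le_trans ot tr)).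
  by apply: in_congl (forces_sym E') _; exact: in_hat.
by have /is_transitiveP := Xt o; apply; [exact: lexx|exact: in_hat|exact: E'].
Qed.

Lemma comparable_check (W : wellOrder) w p : is_ordinal w p -> comparable w (check P W) p.
Proof.
move: w p; apply: comparable_hat => [a|p]; last by have /is_ordinalP[] := check_ordinal W p.
elim/(well_founded_ind (@wo_wf W)): a => a IH; rewrite check_elt_hat.
apply: comparable_hat => [b|p]; first exact: IH (svalP b).
by rewrite -check_elt_hat; exact: check_elt_transitive.
Qed.

Lemma function_congr f x y x' y' p : (x =F x') p -> (y =F y') p ->
  is_function f x y p -> is_function f x' y' p.
Proof.
move=> xx yy /is_functionP[H1 H2 H3]; apply/is_functionP; split=> //.
- move=> z q qp zf; apply: (forces_exE _ (H1 z q qp zf)) => [|u r rq H]; auto with stable.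
  apply: (forces_exE _ H) => [|v s sr [ux [vy zuv]]]; auto with stable.
  have sp := le_trans sr (le_trans rq qp).
  apply: (forces_exI (x := u)); auto with stable.
  apply: (forces_exI (x := v)); auto 6 with stable.
  split; [apply: in_congr ux|split=> //; apply: in_congr vy].
    exact: (forces_mono (stable_eq _ _)) sp xx.
  exact: (forces_mono (stable_eq _ _)) sp yy.
- move=> u q qp ux; apply: H2 => //; apply: in_congr ux.
  by apply: forces_sym; exact: (forces_mono (stable_eq _ _)) qp xx.
Qed.

Lemma stable_countable x : stable (is_countable x).
Proof. exact: stable_ex. Qed.

Lemma countable_congr x y p : (x =F y) p -> is_countable x p -> is_countable y p.
Proof.
move=> xy; move=> H; apply: (forces_exE _ H) => [|f q qp [ff fi]];
  first exact: stable_countable.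
apply: (forces_exI (x := f)).
  by apply: stable_down; apply: stable_and; [exact: stable_function|exact: stable_injective].
split=> //; apply: function_congr ff; last exact: forces_refl.
exact: (forces_mono (stable_eq _ _)) qp xy.
Qed.

End Ordinals.

(** * The first uncountable ordinal in a sigma-closed extension *)

Section Omega1.
Context {d : Order.disp_t} {P : porderType d}.
Implicit Types (x y z u v w f : name P) (p q r : P).

Definition sigma_closed : Prop :=
  forall b : nat -> P, (forall n, (b n.+1 <= b n)%O) -> exists r, forall n, (r <= b n)%O.

Hypothesis P_sigma_closed : sigma_closed.

(** A descending sequence decides at step [n] which element goes to [n], whenever some extension
    does. Below a lower bound the whole injection is decided, so it exists in the ground model. *)
Lemma uncountable_forced A (F : A -> nat -> set P) p :
  ~ ([set: A] #<= [set: nat]) -> ~ forced_injection F p.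
Proof.
move=> Au [Fd Ff Fi Ft]; apply: Au.
have step n q : exists r, (r <= q)%O /\
    ((exists s a, (s <= q)%O /\ F a n s) -> exists a, F a n r).
  have [[s [a [sq Fs]]]|nF] := pselect (exists s a, (s <= q)%O /\ F a n s).
    by exists s; split=> // _; exists a.
  by exists q.
have {step}[g gP] := choice (fun nq : nat * P => step nq.1 nq.2).
pose b := fix b n := if n is m.+1 then g (m, b m) else p.
have bd n : (b n.+1 <= b n)%O by have [] := gP (n, b n).
have [r rb] := P_sigma_closed bd.
have rF a : exists n, exists2 s, (s <= r)%O & F a n s.
  by have [s sr [n Fs]] := Ft a r (rb 0); exists n, s.
have [e eP] := choice rF.
apply/card_leTTP; exists e => a a' ea.
(* Since [s] extends [b n], the next term has decided some [c'] for [n]; as [s] also extends that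
   term, injectivity gives [c = c']. *)
have key c s n : (s <= r)%O -> F c n s -> F c n (b n.+1) .
  move=> sr Fs; have [_ /=] := gP (n, b n).
  case=> [|c' Fc']; first by exists s, c; split=> //; exact: le_trans sr (rb n).
  rewrite [c](Fi c c' n s) //; exact: Fd (le_trans sr (rb n.+1)) Fc'.
have [s sr Fs] := eP a; have [s' sr' Fs'] := eP a'.
apply: (Fi a a' (e a) (b (e a).+1)); first exact: key sr Fs.
by rewrite ea; exact: key sr' Fs'.
Qed.

Lemma check_uncountable (W : wellOrder) p :
  ~ ([set: W] #<= [set: nat]) -> ~ is_countable (check P W) p.
Proof.
move=> Wu Wc; have [q qp [f [ff fi]]] := Wc p (lexx p).
apply: (uncountable_forced Wu).
exact: (forced_injection_maps (@check_elt_separated _ P W) (@check_elt_separated _ P omega)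
  ff fi).
Qed.

Variable W1 : wellOrder.
Hypothesis W1_uncountable : ~ ([set: W1] #<= [set: nat]).
Hypothesis W1_segments : forall a : W1, [set b | (b < a)%O] #<= [set: nat].

Lemma check_elt_countable (a : W1) p : is_countable (check_elt P a) p.
Proof.
have /card_le_sigP/card_leTTP[g gi] := W1_segments a.
rewrite check_elt_hat.
exact: (@injection_le_card _ P _ _ _ _ g p (@check_elt_separated_below _ P W1 a)
  (@check_elt_separated _ P omega) gi).
Qed.

Lemma is_omega1_check p : is_omega1 (check P W1) p.
Proof.
split; first exact: check_ordinal.
split=> [q qp|]; first exact: check_uncountable.
apply/forces_allP => [|v]; first by move=> v; apply: stable_imp; auto with stable.
apply/forces_impP => [||q qp /in_hatP vW]; auto with stable; first exact: stable_countable.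
apply: (dense_elim (stable_countable _) vW) => r rq [a E].
by apply: countable_congr (forces_sym E) _; exact: check_elt_countable.
Qed.

(** By comparability: [check P W1] as an element of [w] would be countable, and [w] as an element of
    [check P W1] would be a countable [check_elt]. *)
Lemma is_omega1_eq w p : is_omega1 w p -> (w =F check P W1) p.
Proof.
move=> [wo [wu /forces_allP wc]].
apply: (dense_elim _ (comparable_check W1 wo)); auto with stable => q qp [Ww|//|wW].
  exfalso; apply: (check_uncountable (p := q) W1_uncountable).
  move: (wc (fun v => stable_imp _ (stable_down (stable_in _ _))) (check P W1)) =>
    /forces_impP.
  by apply; auto with stable; exact: stable_countable.
move/in_hatP: wW => /(_ q (lexx q))[r rq [a E]]; exfalso.
apply: (wu r (le_trans rq qp)); apply: countable_congr (forces_sym E) _.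
exact: check_elt_countable.
Qed.

End Omega1.

(** * The Cantor-Bernstein argument for a generic injection and a ground model one *)

Section CantorBernstein.
Context {d : Order.disp_t} {P : porderType d}.
Variables (A B : Type) (F : A -> B -> set P) (g : B -> A) (p : P).
Hypotheses (Finj : forced_injection F p) (ginj : injective g).

(* The Cantor-Bernstein chain: the closure of the complement of the range of g
   under the composite of the generic injection and g. *)
Fixpoint chain (n : nat) (a : A) : set P :=
  if n is m.+1 then [set q | exists a' b, [/\ a = g b, F a' b q & chain m a' q]]
  else [set q | forall b, a <> g b].

Definition in_chain a : set P := [set q | exists n, chain n a q].

(** The usual bijection: the generic injection on the chain and the inverse of [g] off it. Being off
    the chain means that no extension enters it. *)
Definition cb_rel a b : set P := [set q |
  (F a b q /\ in_chain a q) \/ (a = g b /\ forall r, (r <= q)%O -> ~ in_chain a r)].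

Lemma chain_down n a : down_closed (chain n a).
Proof.
elim: n a => [a q r rq //|n IH a q r rq /= [a' [b [-> Fq Cq]]]]; exists a', b; split=> //.
  exact: (finj_down Finj) rq Fq.
exact: IH Cq.
Qed.

Lemma cb_injection : forced_injection cb_rel p.
Proof.
have Cd a : down_closed (in_chain a).
  by move=> q r rq [n Cq]; exists n; exact: chain_down Cq.
split.
- move=> a b q r rq [[Fq Cq]|[-> nC]]; [left|right]; split=> //.
  + exact: (finj_down Finj) rq Fq.
  + exact: Cd Cq.
  + by move=> s sr; apply: nC; exact: le_trans rq.
- move=> a b b' q [[Fq Cq]|[ab nC]] [[Fq' Cq']|[ab' nC']].
  + exact: (finj_fun Finj) Fq Fq'.
  + by case: (nC' q).
  + by case: (nC q).
  + by apply: ginj; rewrite -ab.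
(* The chain is closed under the generic injection followed by [g], so a point on it and a point off
   it never share a value. *)
- have mix a a' b q : F a b q -> in_chain a q -> a' = g b -> in_chain a' q.
    by move=> Fq [n Cq] ab; exists n.+1; exists a, b.
  move=> a a' b q [[Fq Cq]|[ab nC]] [[Fq' Cq']|[ab' nC']].
  + exact: (finj_inj Finj) Fq Fq'.
  + by case: (nC' q) => //; exact: mix Fq Cq ab'.
  + by case: (nC q) => //; exact: mix Fq' Cq' ab.
  + by rewrite ab.
- move=> a q qp; have [[r rq Cr]|nC] := pselect (exists2 r, (r <= q)%O & in_chain a r).
    have [s sr [b Fs]] := finj_total Finj a (le_trans rq qp).
    by exists s; [exact: le_trans rq|exists b; left; split=> //; exact: Cd Cr].
  have [[b ab]|nb] := pselect (exists b, a = g b).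
    by exists q => //; exists b; right; split=> // r rq Cr; apply: nC; exists r.
  by exfalso; apply: nC; exists q => //; exists 0 => b ab; apply: nb; exists b.
Qed.

Lemma cb_onto : forced_onto cb_rel p.
Proof.
move=> b q qp; have [[r rq [[|n] Cr]]|nC] := pselect (exists2 r, (r <= q)%O & in_chain (g
  b) r).
- by case: (Cr b).
(* A successor stage of the chain at [g b] comes from some [a'] on the chain that the generic
   injection sends to [b]. *)
- case: Cr => a' [b' [/ginj <- Fr Cr]]; exists r => //; exists a'; left; split=> //.
  by exists n.
- by exists q => //; exists (g b); right; split=> // r rq Cr; apply: nC; exists r.
Qed.

End CantorBernstein.

(** * From an injection of nu into h to cardinality omega_1 *)

Section Collapse.
Context {d : Order.disp_t} {P : porderType d}.
Hypothesis P_sigma_closed : @sigma_closed _ P.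
Variables nu h : wellOrder.
Hypothesis nu_uncountable : ~ ([set: nu] #<= [set: nat]).

Lemma eq_card_congr x y z p : (y =F z) p -> eq_cardF (P := P) x y p -> eq_cardF x z p.
Proof.
move=> yz H; apply: (forces_exE _ H) => [|f q qp [ff [fi fo]]]; first exact: stable_ex.
move: (forces_mono (stable_eq _ _) qp yz) => {}yz.
apply: (forces_exI (x := f)).
  apply: stable_down; apply: stable_and; first exact: stable_function.
  by apply: stable_and; [exact: stable_injective|exact: stable_onto].
split; first exact: function_congr (forces_refl _ _) yz ff.
split=> //; move/is_ontoP: fo => fo; apply/is_ontoP => v r rq vz; apply: fo => //.
by apply: in_congr vz; apply: forces_sym; exact: (forces_mono (stable_eq _ _)) rq yz.
Qed.

Lemma forced_injection_comp A B C (F : A -> B -> set P) (G : B -> C -> set P) p :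
  forced_injection F p -> forced_injection G p ->
  forced_injection (fun a c => [set q | exists2 b, F a b q & G b c q]) p.
Proof.
move=> [Fd Ff Fi Ft] [Gd Gf Gi Gt]; split.
- by move=> a c q r rq [b Fq Gq]; exists b; [exact: Fd Fq|exact: Gd Gq].
- by move=> a c c' q [b Fq Gq] [b' /(Ff _ _ _ _ Fq) <-]; exact: Gf Gq.
- by move=> a a' c q [b Fq Gq] [b' Fq' Gq']; move: Fq'; rewrite -(Gi _ _ _ _ Gq Gq');
  exact: Fi Fq.
- move=> a q qp; have [r rq [b Fr]] := Ft a q qp.
  have [s sr [c Gs]] := Gt b r (le_trans rq qp).
  by exists s; [exact: le_trans rq|exists c, b => //; exact: Fd Fr].
Qed.

Lemma forced_injection_mono A B (F : A -> B -> set P) p q : (q <= p)%O ->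
  forced_injection F p -> forced_injection F q.
Proof.
by move=> qp [Fd Ff Fi Ft]; split=> // a; exact: dense_below_down qp (Ft a).
Qed.

Lemma collapse_to_omega1 :
  holds_in_extensions (le_cardF (check P nu) (check P h)) ->
  holds_in_extensions (card_omega1 (check P h)) ->
  holds_in_extensions (card_omega1 (check P nu)).
Proof.
move=> nuh hw1 p.
(* [W1] is omega_1 of the ground model, with an injection [g] into [nu]. *)
have [W1 [W1u W1s /card_leTTP[g gi]]] := least_large nu_uncountable.
apply: (forces_exI (x := check P W1)).
  apply: stable_down; apply: stable_and; last exact: stable_ex.
  apply: stable_and; first exact: stable_ordinal.
  apply: stable_and; last exact: stable_all.
  exact: stable_perp (stable_down (stable_countable _)).
split; first exact: is_omega1_check.
apply: (stableP (stable_ex _)) => q qp.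
have [r rq [w [ww wh]]] := hw1 p q qp.
(* The witness [w] need not be a canonical name, but it is forced equal to [check P W1]. *)
have := eq_card_congr (is_omega1_eq P_sigma_closed W1u W1s ww) wh.
move=> /(_ r (lexx r))[s sr [f2 [f2f [f2i f2o]]]].
have [t ts [f1 [f1f f1i]]] := nuh s s (lexx s).
exists t; first exact: le_trans ts (le_trans sr rq).
have sep W := @check_elt_separated _ P W.
have H1 := forced_injection_maps (sep nu) (sep h) f1f f1i.
have H2 := forced_injection_mono ts (forced_injection_maps (sep h) (sep W1) f2f f2i).
have H := forced_injection_comp H1 H2.
exact: (forced_bijection_eq (sep nu) (sep W1) (cb_injection H gi) (cb_onto _ gi)).
Qed.

End Collapse.

(** * Reduced powers *)

Definition unbounded (S : set nat) : Prop := forall n, exists2 m, (n <= m)%N & S m.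

Definition eventually_all (S : set nat) : Prop := exists n, forall m, (n <= m)%N -> S m.

Definition almost_sub (S S' : set nat) : Prop := eventually_all [set n | S n -> S' n].

Lemma near_eventually (S : set nat) : (\forall i \near \oo, S i) <-> eventually_all S.
Proof. by split=> [[n _ H]|[n H]]; exists n => // m; exact: H. Qed.

Lemma eventually_and S S' : eventually_all S -> eventually_all S' ->
  eventually_all (S `&` S').
Proof.
move=> [n H] [n' H']; exists (maxn n n') => m; rewrite geq_max => /andP[nm nm'].
by split; [exact: H|exact: H'].
Qed.

Lemma eventually_mono (S S' : set nat) : (forall n, S n -> S' n) ->
  eventually_all S -> eventually_all S'.
Proof. by move=> SS [n H]; exists n => m /H/SS. Qed.

Lemma unbounded_eventually S S' : unbounded S -> eventually_all S' -> unbounded (S `&` S').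
Proof.
move=> Su [n H] k; have [m] := Su (maxn n k); rewrite geq_max => /andP[nm km] Sm.
by exists m => //; split=> //; exact: H.
Qed.

Lemma unbounded_mono (S S' : set nat) : (forall n, S n -> S' n) -> unbounded S -> unbounded S'.
Proof. by move=> SS Su n; have [m nm /SS] := Su n; exists m. Qed.

Lemma almost_sub_trans S1 S2 S3 : almost_sub S1 S2 -> almost_sub S2 S3 -> almost_sub S1 S3.
Proof.
by move=> H1 H2; apply: eventually_mono (eventually_and H1 H2) => n /= [h1 h2] /h1/h2.
Qed.

Lemma sub_almost_sub (S S' : set nat) : S `<=` S' -> almost_sub S S'.
Proof. by move=> SS; exists 0 => m _; exact: SS. Qed.

Lemma almost_sub_inter (S1 S2 S : set nat) : almost_sub S1 S2 ->
  unbounded (S `&` S1) -> unbounded (S `&` S2).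
Proof.
move=> SS /unbounded_eventually/(_ SS); apply: unbounded_mono => n [[Sn S1n]] /=.
by move=> /(_ S1n).
Qed.

Lemma not_unbounded S : ~ unbounded S -> eventually_all (~` S).
Proof.
move=> /existsNP[n nS]; exists n => m nm Sm; apply: nS; by exists m.
Qed.

Lemma eventually_forall_le k (Q : nat -> set nat) : (forall n, eventually_all (Q n)) ->
  eventually_all [set i | forall n, (n <= k)%N -> Q n i].
Proof.
move=> Qe; elim: k => [|k IH].
  by apply: eventually_mono (Qe 0) => i Qi n; rewrite leqn0 => /eqP ->.
apply: eventually_mono (eventually_and IH (Qe k.+1)) => i [Qi Qki] n.
by rewrite leq_eqVlt ltnS => /orP[/eqP ->|/Qi].
Qed.

Lemma diagonal_sequence (S : nat -> set nat) : (forall k, unbounded (S k)) ->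
  exists2 m : nat -> nat, forall k, S k (m k) & forall k l, (k < l)%N -> (m k < m l)%N.
Proof.
move=> Su.
have step (kn : nat * nat) : exists m, (kn.2 <= m)%N /\ S kn.1 m.
  by have [m ? ?] := Su kn.1 kn.2; exists m.
have {step}[g gP] := choice step.
pose m := fix m k := if k is l.+1 then g (k, (m l).+1) else g (0, 0).
exists m => [[|k]|]; [by have [] := gP (0, 0)|by have [] := gP (k.+1, (m k).+1)|].
apply: (homo_ltn (r := fun k l => (k < l)%N)) => [l k n|k]; first exact: ltn_trans.
by have [] := gP (k.+1, (m k).+1).
Qed.

(** Take the range of an increasing sequence whose [k]-th term lies in all of [S 0], ..., [S k]. *)
Lemma pseudo_intersection (S : nat -> set nat) :
  (forall n, unbounded (S n)) -> (forall n, almost_sub (S n.+1) (S n)) ->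
  exists2 S', unbounded S' & forall n, almost_sub S' (S n).
Proof.
move=> Su Sd.
have S0 n k : (n <= k)%N -> almost_sub (S k) (S n).
  elim: k => [|k IH]; first by rewrite leqn0 => /eqP ->; exact: sub_almost_sub.
  rewrite leq_eqVlt ltnS => /orP[/eqP ->|/IH]; first exact: sub_almost_sub.
  exact: almost_sub_trans (Sd k).
have Tu k : unbounded [set i | forall n, (n <= k)%N -> S n i].
  have H : eventually_all [set i | forall n, (n <= k)%N -> (n <= k)%N -> S k i -> S n i].
    apply: eventually_forall_le => n; case: (leqP n k) => [/S0|nk].
      by apply: eventually_mono => i /= H _.
    by exists 0.
  apply: unbounded_mono (unbounded_eventually (Su k) H) => i [Sk Hi] n nk.
  exact: Hi.
have [m mP mi] := diagonal_sequence Tu.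
have ml : forall k, (k <= m k)%N.
  by elim=> // k IH; apply: leq_ltn_trans IH (mi _ _ (ltnSn k)).
exists (range m) => [k|n]; first by exists (m k) => //; exists k.
exists (m n) => i + [k _ ki]; rewrite -{i}ki leqNgt => mnk; apply: mP; rewrite leqNgt.
by apply: contra mnk; exact: mi.
Qed.

(** * Representatives and sigma-closure of the reduced power *)

Section ReducedPowerOrder.
Context {d : Order.disp_t} {B : ctbDistrLatticeType d}.
Implicit Types (p q : pos (rp B)) (b : nat -> B).

Definition rep p : nat -> B := repr (val p).

Lemma rep_leP p q : (p <= q)%O <-> eventually_all [set i | (rep p i <= rep q i)%O].
Proof.
rewrite -near_eventually; have := rp_leE (rep p) (rep q); rewrite !reprK; exact.
Qed.

Lemma rep_unbounded p : unbounded [set i | rep p i != \bot%O].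
Proof.
apply: contrapT => /not_unbounded H; have /negP := valP p; apply.
rewrite -[val p]reprK; apply/eqP/eqP; rewrite piE; apply/asboolP/near_eventually.
by apply: eventually_mono H => i /negP/negPn/eqP.
Qed.

(** The representative chosen by [rep] agrees with [b] only from some place on, hence the form of
    the conclusion. *)
Lemma rp_mk b : unbounded [set i | b i != \bot%O] ->
  exists p, eventually_all [set i | rep p i = b i].
Proof.
move=> bu.
have nb : (\pi_(rp B)%qT b : rp B) != \bot%O.
  apply/negP; rewrite piE => /asboolP/near_eventually/(unbounded_eventually bu).
  by move=> /(_ 0)[m _ [/eqP]].
exists (exist (fun x : rp B => x != \bot%O) _ nb : pos (rp B)); apply/near_eventually;
  exact: rp_reprE.
Qed.

(** Diagonalisation: at the place [m k] the lower bound copies the [k]-th condition, where it is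
    nonzero and below all earlier ones. *)
Lemma rp_sigma_closed : @sigma_closed _ (pos (rp B)).
Proof.
move=> b bd.
have b0 n k : (n <= k)%N -> (b k <= b n)%O.
  elim: k => [|k IH]; first by rewrite leqn0 => /eqP ->.
  by rewrite leq_eqVlt ltnS => /orP[/eqP -> //|/IH]; exact: le_trans (bd k).
pose T k := [set i | rep (b k) i != \bot%O] `&`
  [set i | forall n, (n <= k)%N -> (rep (b k) i <= rep (b n) i)%O].
have Tu k : unbounded (T k).
  apply: unbounded_eventually; first exact: rep_unbounded.
  have H : eventually_all [set i | forall n, (n <= k)%N -> (n <= k)%N -> (rep (b k) i <=
    rep (b n) i)%O].
    apply: eventually_forall_le => n; case: (leqP n k) => [/b0/rep_leP|nk].
      by apply: eventually_mono => i /= H _.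
    by exists 0.
  by apply: eventually_mono H => i Hi n nk; exact: Hi.
have [m mP mi] := diagonal_sequence Tu.
have ml : forall k, (k <= m k)%N.
  by elim=> // k IH; apply: leq_ltn_trans IH (mi _ _ (ltnSn k)).
have minj k l : m k = m l -> k = l.
  by move=> e; case: (ltngtP k l) => // /mi; rewrite e ltnn.
(* Bottom off the range of [m] keeps [c] below every condition there. *)
pose c i := if pselect (exists k, m k = i) is left E then rep (b (projT1 (cid E))) i else
  \bot%O.
have cm k : c (m k) = rep (b k) (m k).
  rewrite /c; case: pselect => [E|[]]; last by exists k.
  by rewrite (minj _ _ (projT2 (cid E))).
have [|r rc] := @rp_mk c.
  by move=> k; exists (m k) => //=; rewrite cm; case: (mP k).
exists r => n; apply/rep_leP.
have H : eventually_all [set i | (c i <= rep (b n) i)%O].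
  exists (m n) => i mni /=; have [[k ki]|nk] := pselect (exists k, m k = i).
    rewrite -ki cm; have [_] := mP k; apply; rewrite leqNgt.
    by apply/negP => /mi; rewrite ki ltnNge mni.
  by rewrite /c; case: pselect => // _; exact: le0x.
by apply: eventually_mono (eventually_and rc H) => i /= [-> ].
Qed.

End ReducedPowerOrder.

(** * Choice along well-orders and almost disjoint families *)

(** Recursion in which a next value exists only if the earlier values were well chosen. The first
    hypothesis on [Q] says that the requirement at [a] looks only at values below [a]. *)
Lemma wf_choice (A U : Type) (R : A -> A -> Prop) (Q : (A -> U) -> A -> U -> Prop) (u0 : U) :
  well_founded R ->
  (forall f g a u, (forall a', R a' a -> f a' = g a') -> Q f a u -> Q g a u) ->
  (forall f a, (forall a', R a' a -> Q f a' (f a')) -> exists u, Q f a u) ->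
  exists f, forall a, Q f a (f a).
Proof.
move=> Rwf Qext Qex.
(* Totalises the values below [a] by the default [u0], so that [Q] can be asked of a partial
   construction. *)
pose ext a (rec : forall a', R a' a -> U) a' :=
  if pselect (R a' a) is left r then rec a' r else u0.
pose step a rec := if pselect (exists u, Q (ext a rec) a u) is left E
  then projT1 (cid E) else u0.
pose f := Fix Rwf (fun=> U) step.
have fE a : f a = step a (fun a' _ => f a').
  rewrite /f Fix_eq // => b g h gh; congr step.
  by apply: functional_extensionality_dep => c; apply: functional_extensionality_dep => r.
exists f => a; elim/(well_founded_ind Rwf): a => a IH.
have [u Qu] := Qex f a IH.
have extE a' : R a' a -> f a' = ext a (fun a' _ => f a') a'.
  by rewrite /ext; case: pselect.
rewrite fE /step; case: pselect => [E|[]]; last by exists u; exact: Qext Qu.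
by apply: Qext (projT2 (cid E)) => a' /extE.
Qed.

(** A well-order of least type: if [C] injects into some proper segment of an arbitrary one, pull
    the order back along an injection into the least such segment. *)
Lemma initial_well_order (C : Type) : exists R : C -> C -> Prop,
  [/\ well_founded R, forall x y, [\/ R x y, x = y | R y x] &
    forall x (f : C -> C), injective f -> ~ forall y, R (f y) x].
Proof.
have [R Rwf Rtot] : exists2 R : C -> C -> Prop,
    well_founded R & forall x y, [\/ R x y, x = y | R y x].
  elim/Peq : C => C; have [R Rwo] := well_ordering_principle C.
  exists (fun x y => R x y /\ x != y).
    suff H : forall A : pred C, (forall x, ~~ A x -> exists2 y, R y x /\ y != x & ~~ A y)
      -> forall x, A x.
      pose A x := `[< Acc (fun x y => R x y /\ x != y) x >].
      move=> x; apply/asboolP; apply: (H A) => {}x; move=> /asboolPn nA;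
        apply: contrapT => nex.
      apply: nA; constructor=> y yx; apply/asboolP; apply: contrapT => /negP nAy; apply: nex.
      by exists y.
    move=> A HA x; apply: contrapT => /negP nAx.
    have [|z [[zA zmin] _]] := Rwo [pred y : C | ~~ A y]; first by exists x.
    have [y [Ryz yz] nAy] := HA z zA.
    have [|t [_ tu]] := Rwo (pred2 y z).
      by exists y; rewrite !inE eqxx.
    (* [y] and [z] precede each other, so both are least in the pair, and uniqueness of the least
       element identifies them. *)
    have Rzy := zmin y nAy.
    have Rr : forall w, R w w.
      by move=> w; have [|v [[]]] := Rwo (pred1 w); [exists w;
        rewrite inE|rewrite !inE => /eqP -> H _ ; apply: H; rewrite inE].
    have ty : t = y.
      by apply: tu; split=> [|w]; rewrite !inE ?eqxx // => /orP[] /eqP ->.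
    have tz : t = z.
      by apply: tu; split=> [|w]; rewrite !inE ?eqxx ?orbT // => /orP[] /eqP ->.
    by rewrite -ty -tz eqxx in yz.
  move=> x y; have [->|xy] := eqVneq x y; first exact: Or32.
  have [|t [[]]] := Rwo (pred2 x y); first by exists x; rewrite !inE eqxx.
  rewrite !inE => /orP[] /eqP -> tm _.
    by apply: Or31; split=> //; apply: tm; rewrite !inE eqxx orbT.
  by apply: Or33; split; [apply: tm; rewrite !inE eqxx|].
pose big x := exists2 f : C -> C, injective f & forall y, R (f y) x.
have [[x xb]|nbig] := pselect (exists x, big x); last first.
  by exists R; split=> // x f fi fx; apply: nbig; exists x, f.
elim/(well_founded_ind Rwf): x xb => x IH [f fi fx].
have [[y yx yb]|nb] := pselect (exists2 y, R y x & big y); first exact: IH yx yb.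
(* A further injection [g] into the segment of some [y] would make [f y] big and smaller than
   [x]. *)
exists (fun y z => R (f y) (f z)); split.
- by apply: (wf_inverse_image _ _ _ f).
- by move=> y z; case: (Rtot (f y) (f z)) => [?|/fi ?|?];
  [exact: Or31|exact: Or32|exact: Or33].
- move=> y g gi gy; apply: nb; exists (f y) => //; exists (f \o g) => //.
  exact: inj_comp.
Qed.

(** Choose along a well-order of [C] of least type. If all candidates of [j] were taken by
    predecessors, [C] would inject into the proper segment below [i j]. *)
Lemma injective_selection (J C U : Type) (i : J -> C) (b : J -> C -> U) :
  injective i -> (forall j, injective (b j)) ->
  exists2 X : J -> U, injective X & forall j, exists y, X j = b j y.
Proof.
move=> ii bi; have [[j0 _]|J0] := pselect (exists j : J, True); last first.
  have nJ (j : J) : False by apply: J0; exists j.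
  by exists (fun j => False_rect U (nJ j)) => j; case: (nJ j).
have [R [Rwf Rtot Rinit]] := initial_well_order C.
pose R' j j' := R (i j) (i j').
have R'wf : well_founded R' by apply: (wf_inverse_image _ _ _ i).
pose Q (f : J -> U) j u := (exists y, u = b j y) /\ forall j', R' j' j -> f j' <> u.
have [||X XQ] := @wf_choice J U R' Q (b j0 (i j0)) R'wf.
- by move=> f g j u fg [uy fu]; split=> // j' j'j; rewrite -fg //; exact: fu.
- move=> f j _; apply: contrapT => nu.
  have H y : exists j', R' j' j /\ f j' = b j y.
    apply: contrapT => nj; apply: nu; exists (b j y); split; first by exists y.
    by move=> j' j'j e; apply: nj; exists j'.
  have [g gP] := choice H.
  apply: (Rinit (i j) (i \o g)) => [x y /ii xy|y]; last by case: (gP y).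
  by apply: (bi j); rewrite -(proj2 (gP x)) -(proj2 (gP y)) xy.
exists X => [j j' e|j]; last by case: (XQ j).
case: (Rtot (i j) (i j')) => [r|/ii//|r].
  by case: (XQ j') => _ /(_ j r).
by case: (XQ j) => _ /(_ j' r); rewrite e.
Qed.

(** Open dense subsets of the positive part of P(omega)/Fin, seen on infinite sets; closure under
    almost inclusion builds in invariance under finite changes. *)
Definition open_dense_sets (D : set (set nat)) : Prop :=
  (forall S S', unbounded S' -> almost_sub S' S -> D S -> D S') /\
  (forall S, unbounded S -> exists S', [/\ unbounded S', almost_sub S' S & D S']).

(** Refine through the families one after the other and take a pseudo-intersection: countably many
    open dense families have a dense intersection. *)
Lemma open_dense_seq (D : nat -> set (set nat)) S :
  (forall n, open_dense_sets (D n)) -> unbounded S ->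
  exists S', [/\ unbounded S', almost_sub S' S & forall n, D n S'].
Proof.
move=> Dod Su.
have step (nT : nat * set nat) : exists T', unbounded nT.2 ->
    [/\ unbounded T', almost_sub T' nT.2 & D nT.1 T'].
  have [Tu|nTu] := pselect (unbounded nT.2); last by exists set0.
  by have [T' ?] := (Dod nT.1).2 _ Tu; exists T'.
have {step}[g gP] := choice step.
pose T := fix T n := if n is k.+1 then g (k, T k) else S.
have Tu n : unbounded (T n).
  by elim: n => // n IH; have [] := gP (n, T n) IH.
have [|S' S'u S'T] := pseudo_intersection Tu.
  by move=> n; have [] := gP (n, T n) (Tu n).
exists S'; split=> // [|n]; first exact: (S'T 0).
have [_ _ Dn] := gP (n, T n) (Tu n).
by apply: (Dod n).1 Dn => //; exact: (S'T n.+1).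
Qed.

Definition almost_disjoint (F : set (set nat)) : Prop :=
  forall X Y, F X -> F Y -> unbounded (X `&` Y) -> X = Y.

(** Zorn's lemma inside [D]. A set almost disjoint from the whole family would have a refinement in
    [D] that could be added. *)
Lemma maximal_almost_disjoint (D : set (set nat)) : open_dense_sets D ->
  exists F, [/\ F `<=` D, almost_disjoint F &
    forall S, unbounded S -> exists2 X, F X & unbounded (S `&` X)].
Proof.
move=> [Dopen Ddense].
pose P F := F `<=` D /\ almost_disjoint F.
have [G GP Gtot|F [[FD Fad] Fmax]] := @Zorn_bigcup (set nat) P.
  split=> [X [F /GP[FD _] /FD]//|X Y [F GF FX] [F' GF' FY] XY].
  case: (Gtot _ _ GF GF') => FF.
    by apply: (GP _ GF').2 => //; exact: FF.
  by apply: (GP _ GF).2 => //; exact: FF.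
exists F; split=> // S Su; apply: contrapT => nS.
have [S' [S'u S'S DS']] := Ddense S Su.
have FS' X : F X -> ~ unbounded (X `&` S').
  move=> FX; move=> /(almost_sub_inter S'S) XS; apply: nS; exists X => //.
  by rewrite setIC.
apply: (Fmax (F `|` [set S'])).
  split; first by move=> X; left.
  move=> /(_ S') H; apply: (FS' S'); first by apply: H; right.
  by rewrite setIid.
split=> [X [/FD//|->//]|X Y [FX|->] [FY|->]//].
- exact: Fad.
- by move=> /(FS' _ FX).
- by rewrite setIC => /(FS' _ FY).
Qed.

(** * Names of functions at the distributivity number *)

Section PomegaFin.
Implicit Types (p q : PomegaFin_pos).

Definition supp p : set nat := [set i | rep p i].

Lemma supp_leP p q : (p <= q)%O <-> almost_sub (supp p) (supp q).
Proof.
rewrite rep_leP; split; apply: eventually_mono => i /=.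
  by rewrite leEbool /supp /=; case: (rep p i); case: (rep q i).
by rewrite leEbool /supp /=; case: (rep p i); case: (rep q i) => //= /(_ isT).
Qed.

Lemma supp_unbounded p : unbounded (supp p).
Proof. by apply: unbounded_mono (rep_unbounded p) => i /eqP; rewrite /supp /=;
  case: (rep p i). Qed.

Lemma supp_surj (S : set nat) : unbounded S ->
  exists p, almost_sub (supp p) S /\ almost_sub S (supp p).
Proof.
move=> Su; have [|p pS] := @rp_mk _ bool (fun i => `[< S i >]).
  by apply: unbounded_mono Su => i Si /=; rewrite asboolT.
exists p; split; apply: eventually_mono pS => i /= E.
  by rewrite /supp /= E => /asboolP.
by rewrite /supp /= E => /asboolP.
Qed.

End PomegaFin.

(** * Consequences of the definition of h *)

Section DistributivityNumber.
Variable h : wellOrder.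
Hypothesis h_is_h : is_h h.

Lemma open_dense_sets_supp (D : set (set nat)) : open_dense_sets D ->
  @open_dense _ PomegaFin_pos [set p | D (supp p)].
Proof.
move=> [Do Dd]; split=> [p q qp /=|p].
  by apply: Do; [exact: supp_unbounded|apply/supp_leP].
have [S [Su Sp DS]] := Dd _ (supp_unbounded p).
have [q [qS Sq]] := supp_surj Su.
exists q; first by apply/supp_leP; exact: almost_sub_trans qS Sp.
exact: Do (supp_unbounded q) qS DS.
Qed.

(** Otherwise the range of [D] is a nondistributive family, and the minimality of [h] injects [h]
    into [J]. *)
Lemma h_intersection (J : Type) (D : J -> set (set nat)) S :
  ~ ([set: h] #<= [set: J]) -> (forall j, open_dense_sets (D j)) -> unbounded S ->
  exists S', [/\ unbounded S', almost_sub S' S & forall j, D j S'].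
Proof.
move=> hJ Dod Su.
pose F := range (fun j => [set p : PomegaFin_pos | D j (supp p)]).
have [Fd|nF] := pselect (dense_in (\bigcap_(X in F) X)).
  have [p [pS Sp]] := supp_surj Su.
  have [q qp Fq] := Fd p; exists (supp q); split; first exact: supp_unbounded.
    by apply: almost_sub_trans pS; apply/supp_leP.
  by move=> j; apply: (Fq [set p | D j (supp p)]); exists j.
exfalso; apply: hJ.
have [_ _ hmin] := h_is_h; suff /hmin/card_leTP[f fi fF] : nondistributive_family F.
  have H x : exists j, [set p | D j (supp p)] = f x by have [j _ e] := fF x; exists j.
  have [g gf] := choice H.
  by apply/card_leTTP; exists g => x y xy; apply: fi; rewrite -!gf xy.
by split=> // _ [j _ <-]; exact: open_dense_sets_supp.
Qed.

(* Homogeneity: the family is carried from below a condition to all of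
   omega by an increasing enumeration of that condition. *)
Lemma h_family : exists D : h -> set (set nat),
  (forall xi, open_dense_sets (D xi)) /\
  (forall S, unbounded S -> exists xi, ~ D xi S).
Proof.
have [_ [F [Fod /existsNP[p0 Fp0]] Fh] _] := h_is_h.
have [f fi] : exists f : {X | F X} -> h, injective f.
  have /card_eqPle[/card_leEP[f fi] _] := Fh.
  by exists (fun X => sval (f X)) => X Y /sval_inj/fi.
(* Reindexes [F] by [h]; an index outside the range of [f] imposes nothing, so its family contains
   every set. *)
pose D xi S := forall X (FX : F X), f (exist _ X FX) = xi ->
  exists2 p, X p & almost_sub S (supp p).
have Dod xi : open_dense_sets (D xi).
  split=> [S S' _ SS DS X FX fX|S Su].
    have [p Xp Sp] := DS X FX fX; exists p => //; exact: almost_sub_trans SS Sp.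
  have [[X [FX fX]]|nX] := pselect (exists X (FX : F X), f (exist _ X FX) = xi).
    have [p [pS Sp]] := supp_surj Su; have [q qp Xq] := (Fod _ FX).2 p.
    exists (supp q); split; first exact: supp_unbounded.
      by apply: almost_sub_trans pS; apply/supp_leP.
    move=> Y FY fY; exists q; last exact: sub_almost_sub.
    have /(congr1 sval)/= -> // : exist _ Y FY = exist _ X FX.
    by apply: fi; rewrite fX.
  by exists S; split=> // [|X FX fX]; [exact: sub_almost_sub|case: nX; exists X, FX].
have [e eS ei] := diagonal_sequence (fun=> supp_unbounded p0).
have el k : (k <= e k)%N.
  by elim: k => // k IH; apply: leq_ltn_trans IH (ei _ _ (ltnSn k)).
have einj : injective e.
  by move=> k l E; case: (ltngtP k l) => // /ei; rewrite E ltnn.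
have eu S : unbounded S -> unbounded (e @` S).
  move=> Su n; have [m nm Sm] := Su n; exists (e m); last by exists m.
  exact: leq_trans nm (el m).
exists (fun xi S => D xi (e @` S)); split=> [xi|S Su].
  split=> [S S' S'u [n S'S]|S Su].
    apply: (Dod xi).1; first exact: eu.
    exists (e n) => i + [m S'm mi]; rewrite -{i}mi leqNgt => enm.
    exists m => //; apply: S'S => //; rewrite leqNgt; apply: contra enm; exact: ei.
  have [S' [S'u [n S'S] DS']] := (Dod xi).2 _ (eu _ Su).
  exists (e @^-1` S'); split.
  - move=> k; have [m + S'm] := S'u (maxn n (e k)).
    rewrite geq_max => /andP[nm ekm]; have [l Sl lm] := S'S m nm S'm.
    exists l; last by rewrite /preimage /= lm.
    by rewrite leqNgt; apply/negP => /ei; rewrite lm ltnNge ekm.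
  - exists n => m nm /= S'm; have [||l Sl /einj <- //] := S'S (e m) => //.
    exact: leq_trans nm (el m).
  - apply: (Dod xi).1 DS'; last by apply: sub_almost_sub => _ [m S'm <-].
    apply: eu => k; have [m + S'm] := S'u (maxn n (e k)).
    rewrite geq_max => /andP[nm ekm]; have [l Sl lm] := S'S m nm S'm.
    exists l; last by rewrite /preimage /= lm.
    by rewrite leqNgt; apply/negP => /ei; rewrite lm ltnNge ekm.
have [p [pS Sp]] := supp_surj (eu _ Su).
(* If [S] lay in every transported family, its image would give a condition below [p0] in all
   members of [F]. *)
apply: contrapT => nD.
have DS xi : D xi (e @` S) by apply: contrapT => ?; apply: nD; exists xi.
apply: Fp0; exists p.
  by apply/supp_leP; apply: almost_sub_trans pS _; apply: sub_almost_sub => _ [m _ <-].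
move=> X FX; have [q Xq Sq] := DS _ X FX erefl.
by apply: (Fod _ FX).1 Xq; apply/supp_leP; exact: almost_sub_trans pS Sq.
Qed.

Lemma h_segment (xi : h) : ~ ([set: h] #<= [set: {eta : h | (eta < xi)%O}]).
Proof.
have [hc _ _] := h_is_h; move=> /card_leTTP[f fi]; apply: (hc xi).
by apply/card_leTP; exists (fun x => sval (f x)) => [x y /sval_inj/fi//|x]; exact: svalP (f x).
Qed.

(** The cofinality of [h] is uncountable: otherwise the families up to each [s n], intersected,
    would be countably many open dense families with no infinite set in common. *)
Lemma h_bounded (s : nat -> h) : exists xi, forall n, (s n < xi)%O.
Proof.
apply: contrapT => nb; have [D [Dod Dempty]] := h_family.
have cof xi : exists n, (xi <= s n)%O.
  apply: contrapT => nx; apply: nb; exists xi => n; rewrite ltNge; apply/negP => xs.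
  by apply: nx; exists n.
have [||S [Su _ DS]] := @open_dense_seq (fun n S => forall xi, (xi <= s n)%O -> D xi S) setT.
(* The fewer than [h] indices below [s n] are met by [h_intersection]; the index [s n] itself takes
   one more refinement. *)
- move=> n; split=> [S S' S'u SS DS xi xn|S Su]; first exact: (Dod xi).1 _ _ S'u SS (DS xi xn).
  have [S1 [S1u S1S D1]] := @h_intersection _ (fun z : {eta : h | (eta < s n)%O} =>
    D (sval z)) S
    (@h_segment (s n)) (fun z => Dod (sval z)) Su.
  have [S2 [S2u S2S D2]] := (Dod (s n)).2 S1 S1u.
  exists S2; split=> //; first exact: almost_sub_trans S2S S1S.
  move=> xi; rewrite le_eqVlt => /orP[/eqP -> //|xn].
  exact: (Dod xi).1 _ _ S2u S2S (D1 (exist _ xi xn)).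
- by move=> n; exists n.
by have [xi] := Dempty S Su; apply; have [n xn] := cof xi; exact: (DS n).
Qed.

(** Indexes the requirements, pairs of a set and a function, by [nat -> bool], the type of the
    branches of a Cantor tree, so that requirements and branches are equally many. *)
Definition decode (x : nat -> bool) : set nat * (nat -> nat) :=
  ([set n | x (pickle (inl n : nat + nat * nat)%type)],
   fun n => if pselect (exists m, x (pickle (inr (n, m) : nat + nat * nat)%type)) is left E
     then projT1 (cid E) else 0).

Lemma decode_surj S a : exists x, decode x = (S, a).
Proof.
exists (fun k => match unpickle k with
  | Some (inl n) => `[< S n >]
  | Some (inr nm) => a nm.1 == nm.2
  | None => false end).
rewrite /decode; congr pair.
  by apply/seteqP; split=> n /=; rewrite pickleK => /asboolP.
apply/funext => n; case: pselect => [E|[]].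
  by have := projT2 (cid E); rewrite pickleK => /eqP.
by exists (a n); rewrite pickleK /=.
Qed.

(* The names are read off maximal almost disjoint families B_xi refining all
   earlier A_eta.  Every S splits along some A_eta, so a Cantor tree of
   splittings shows that S meets continuum many members of some B_xi, enough to
   give each of the continuum many pairs (S, a) its own member. *)
Lemma h_names : exists N : h -> set nat -> (nat -> nat) -> Prop,
  (forall xi X f Y g, N xi X f -> N xi Y g -> unbounded (X `&` Y) -> f = g) /\
  (forall S a, unbounded S -> exists xi X, N xi X a /\ unbounded (S `&` X)).
Proof.
have [D [Dod Dempty]] := h_family.
have [A AP] := choice (fun xi => maximal_almost_disjoint (Dod xi)).
(* The sets that refine all earlier families [A eta] at once. *)
pose E xi X := forall eta, (eta < xi)%O -> exists2 Y, A eta Y & almost_sub X Y.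
have Eod xi : open_dense_sets (E xi).
  split=> [S S' _ SS ES eta /ES[Y AY SY]|S Su].
    by exists Y => //; exact: almost_sub_trans SS SY.
  have G (z : {eta : h | (eta < xi)%O}) :
      open_dense_sets [set X | exists2 Y, A (sval z) Y & almost_sub X Y].
    split=> [T T' _ TT [Y AY TY]|T Tu].
      by exists Y => //; exact: almost_sub_trans TT TY.
    have [_ _ /(_ T Tu)[Y AY TY]] := AP (sval z).
    exists (T `&` Y); split=> //; first by apply: sub_almost_sub => i [].
    by exists Y => //; apply: sub_almost_sub => i [].
  have [S' [S'u S'S GS']] := h_intersection (@h_segment xi) G Su.
  by exists S'; split=> // eta ex; exact: (GS' (exist _ eta ex)).
have [B BP] := choice (fun xi => maximal_almost_disjoint (Eod xi)).
(* [r] consists of a level, two halves of [S], and two distinct members of [A] at that level that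
   cover the halves. *)
have split S : exists r : h * (bool -> set nat) * (bool -> set nat), unbounded S ->
    [/\ forall c, unbounded (r.1.2 c) /\ r.1.2 c `<=` S,
      forall c, A r.1.1 (r.2 c) /\ r.1.2 c `<=` r.2 c & r.2 true <> r.2 false].
  have [Su|nSu] := pselect (unbounded S); last first.
    by have [xi _] := Dempty setT (fun n => ex_intro2 _ _ n (leqnn n) I);
      exists (xi, fun=> set0, fun=> set0).
  have [xi nD] := Dempty S Su; have [AD Aad Amax] := AP xi.
  have [X AX SX] := Amax S Su.
  (* Otherwise [S] is almost contained in [X], hence in [D xi], against the choice of [xi]. *)
  have SXu : unbounded (S `&` ~` X).
    apply: contrapT => /not_unbounded SX'; apply: nD.
    apply: (Dod xi).1 (AD _ AX) => //.
    by apply: eventually_mono SX' => i H Si; apply: contrapT => nX; apply: H.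
  have [Y AY SXY] := Amax _ SXu.
  exists (xi, fun c : bool => if c then S `&` X else S `&` ~` X `&` Y,
    fun c : bool => if c then X else Y) => _ /=; split=> [[]|[]|XY].
  - by split=> // i [].
  - by split=> // i [[]].
  - by split=> // i [].
  - by split=> // i [[]].
  - by have [i _ [[_ nX] Yi]] := SXY 0; apply: nX; rewrite XY.
have {split}[sp spP] := choice split.
pose node S (s : seq bool) := foldl (fun T c => (sp T).1.2 c) S s.
have nodeu S s : unbounded S -> unbounded (node S s).
  move=> Su; elim/last_ind: s => // s c IH; rewrite /node foldl_rcons.
  by have [/(_ c)[]] := spP _ IH.
have branch S (x : nat -> bool) : unbounded S ->
    exists2 S', unbounded S' & forall n, almost_sub S' (node S (mkseq x n)).
  move=> Su; apply: pseudo_intersection => n; first exact: nodeu.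
  rewrite mkseqS /node foldl_rcons; apply: sub_almost_sub.
  by have [/(_ (x n))[]] := spP _ (nodeu S (mkseq x n) Su).
pose rich xi S := exists b : (nat -> bool) -> set nat,
  injective b /\ forall x, B xi (b x) /\ unbounded (S `&` b x).
have richP S : unbounded S -> exists xi, rich xi S.
  move=> Su.
  (* The tree has countably many nodes, enumerated by [unpickle], so a single level [xi] lies above
     all the splitting levels. *)
  have [xi xiP] := h_bounded (fun k => (sp (node S (odflt [::] (unpickle k)))).1.1).
  exists xi; have [BE Bad Bmax] := BP xi.
  have [T TP] := choice (fun x => let: ex_intro2 T H1 H2 := branch S x Su in
     ex_intro (fun T =>
       unbounded T /\ forall n, almost_sub T (node S (mkseq x n))) T (conj H1 H2)).
  have [b bP] := choice (fun x => let: ex_intro2 X H1 H2 := Bmax _ (TP x).1 in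
     ex_intro (fun X => B xi X /\ unbounded (T x `&` X)) X (conj H1 H2)).
  exists b; split=> [x y xy|x]; last first.
    split; first by case: (bP x).
    rewrite setIC; apply: (almost_sub_inter ((TP x).2 0)).
    by rewrite setIC; case: (bP x).
  apply/funext => n0; apply: contrapT => nxy.
  have [n xyn nmin] : exists2 n, x n <> y n & forall m, (m < n)%N -> x m = y m.
    have ex : exists n, x n != y n by exists n0; apply/eqP.
    exists (ex_minn ex); case: ex_minnP => n /eqP // _ nmin m; apply: contraTeq => /nmin.
    by rewrite leqNgt.
  set s := mkseq x n.
  have sy : mkseq y n = s.
    by rewrite /s /mkseq; apply/eq_in_map => m; rewrite mem_iota add0n => /nmin.
  have [_ AY Yneq] := spP _ (nodeu S s Su).
  (* [b z] meets [T z] infinitely often and [T z] is almost inside the cover of the half [z n]; by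
     almost disjointness no other member of that family almost contains [b z]. Hence [b x = b y]
     would identify the two covers. *)
  have key z : mkseq z n = s -> forall Z, A (sp (node S s)).1.1 Z -> almost_sub (b z) Z ->
      Z = (sp (node S s)).2 (z n).
    move=> zs Z AZ bZ; have [_ Aad _] := AP (sp (node S s)).1.1.
    have [AYz Yz] := AY (z n); apply: Aad => //.
    have [_ Tz] := bP z; have := almost_sub_inter bZ Tz; rewrite setIC.
    apply: almost_sub_inter; apply: almost_sub_trans ((TP z).2 n.+1) _.
    rewrite mkseqS zs /node foldl_rcons; exact: sub_almost_sub.
  have xis : ((sp (node S s)).1.1 < xi)%O by have := xiP (pickle s); rewrite pickleK.
  have [Z AZ bZ] := BE _ (bP x).1 _ xis.
  have := key x erefl Z AZ bZ; have := key y sy Z AZ; rewrite -xy => /(_ bZ) -> Yxy.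
  by apply: Yneq; move: xyn Yxy; case: (x n); case: (y n) => // _ ->.
(* The requirements rich at level [xi] form a subset of [nat -> bool], and each has [nat -> bool]
   many candidates, so distinct members of [B xi] can be assigned to them. *)
have sel xi : exists X : {x | rich xi (decode x).1} -> set nat, injective X /\
    forall x, B xi (X x) /\ unbounded ((decode (sval x)).1 `&` X x).
  have [b bP] := choice (fun x : {x | rich xi (decode x).1} => svalP x).
  have [X Xi XP] := injective_selection (@sval_inj _ _) (fun x => (bP x).1).
  by exists X; split=> // x; have [y ->] := XP x; exact: (bP x).2.
exists (fun xi Y f => exists2 x, Y = projT1 (cid (sel xi)) x & f = (decode (sval x)).2).
split=> [xi|S a Su].
  case: (cid (sel xi)) => X [Xi XB] /= _ _ _ _ [x -> ->] [y -> ->] XY.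
  (* Two members of [B xi] with infinite intersection coincide, and an injective assignment makes
     their requirements coincide. *)
  congr (decode (sval _)).2; apply: Xi; have [_ Bad _] := BP xi.
  by apply: Bad XY; [exact: (XB x).1|exact: (XB y).1].
have [xi richS] := richP S Su; have [x xS] := decode_surj S a.
have rx : rich xi (decode x).1 by rewrite xS.
exists xi, (projT1 (cid (sel xi)) (exist _ x rx)).
split; first by exists (exist _ x rx); rewrite // [sval _]/= xS.
have -> : S = (decode x).1 by rewrite xS.
by have [_ /(_ (exist _ x rx))[]] := projT2 (cid (sel xi)).
Qed.

End DistributivityNumber.

(** * Coding nodes in segments of the tree *)

Lemma card_le_total (M : wellOrder) (T : Type) :
  [set: M] #<= [set: T] \/ [set: T] #<= [set: M].
Proof.
have [|TM] := pselect ([set: T] #<= [set: M]); [by right|left].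
have [t0 _] : exists t : T, True.
  apply: contrapT => nT; apply: TM; have nT' (t : T) : False by apply: nT; exists t.
  by apply/card_leTTP; exists (fun t => False_rect _ (nT' t)) => t; case: (nT' t).
have [||f fP] := @wf_choice M T (fun x y => (x < y)%O)
    (fun f a u => forall b, (b < a)%O -> f b <> u) t0 (@wo_wf M).
- by move=> f g a u fg fu b ba; rewrite -fg //; exact: fu.
- move=> f a _; apply: contrapT => nu; apply: TM.
  have H u : exists b, f b = u.
    by apply: contrapT => nb; apply: nu; exists u => b _ e; apply: nb; exists b.
  by have [g gP] := choice H; apply/card_leTTP; exists g => x y xy; rewrite -(gP x) xy.
apply/card_leTTP; exists f => a b ab; case: (ltgtP a b) => //.
  by move=> /(fP b).
by move=> /(fP a); rewrite ab.
Qed.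

(** A larger segment would contain a cardinal above [mu]; by minimality [nu] would embed in it, and
    so in a proper segment of itself. *)
Lemma successor_segment (nu mu : wellOrder) (a : nu) : is_successor_cardinal nu mu ->
  [set b | (b < a)%O] #<= [set: mu].
Proof.
move=> [nuc [munu numu] numin]; apply: contrapT => al.
have [|W [Wl Ws Wa]] := @least_large (seg_wo a) mu.
  by move=> H; apply: al; apply/card_le_sigP.
have Wc : is_cardinal W by move=> b Wb; apply: Wl; exact: card_le_trans Wb (Ws b).
have muW : card_lt mu W.
  by split=> //; case: (card_le_total mu W).
have /card_leTTP[f fi] := card_le_trans (numin W Wc muW) Wa.
apply: (nuc a); apply/card_leTP; exists (fun x => val (f x)) => [x y /val_inj/fi//|x].
exact: (svalP (f x)).
Qed.

(** Running maxima of an enumeration of a countable cofinal set. A largest element would be cofinal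
    alone, and a singleton does not contain a copy of omega. *)
Lemma cofinal_sequence (W : wellOrder) : has_cofinality W omega ->
  (forall x : W, exists y, (x < y)%O) /\
  exists c : nat -> W, forall x, eventually_all [set n | (x < c n)%O].
Proof.
move=> [[A Acof Aomega] Wcof].
have Wmax x : exists y : W, (x < y)%O.
  apply: contrapT => nx; have /card_leTP[f fi fx] : [set: omega] #<= [set x].
    apply: Wcof => y; exists x => //; rewrite leNgt; apply/negP => xy; apply: nx.
    by exists y.
  by have /fi : f 0 = f 1 by rewrite (fx 0) (fx 1).
split=> //; have /card_eqPle[/card_leEP[f fi] /card_leTP[g _ gA]] := Aomega.
(* The element of [A] with number [n]; if there is none, [g 0] is a harmless default. *)
have H n : exists x : W, forall y : {x | A x}, sval (f y) = n -> sval y = x.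
  have [[y yn]|ny] := pselect (exists y, sval (f y) = n).
    by exists (sval y) => z zn; congr sval; apply: fi; apply: sval_inj; rewrite yn.
  by exists (g 0) => y yn; case: ny; exists y.
have [e eP] := choice H.
pose c := fix c n := if n is k.+1 then Order.max (c k) (e n) else e 0.
have ec n k : (k <= n)%N -> (e k <= c n)%O.
  elim: n => [|n IH]; first by rewrite leqn0 => /eqP ->.
  by rewrite leq_eqVlt ltnS le_max => /orP[/eqP ->|/IH ->//]; rewrite lexx orbT.
exists c => x; have [y xy] := Wmax x; have [z Az yz] := Acof y.
exists (sval (f (exist _ z Az))) => n /ec; rewrite -(eP _ (exist _ z Az)) //=.
by apply: lt_le_trans; exact: lt_le_trans yz.
Qed.

(* At stage a, the earlier functions are enumerated along mu; the n-th value
   has to avoid only those enumerated below the n-th term of a cofinal sequence. *)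
Lemma eventually_different_family (nu mu : wellOrder) (T : Type) :
  is_successor_cardinal nu mu -> is_cardinality_of mu T -> has_cofinality mu omega ->
  exists g : nu -> nat -> T, forall a b, a <> b -> eventually_all [set n | g a n <> g b n].
Proof.
move=> numu [muc muT] /cofinal_sequence[_ [c cP]].
have /card_eqPle[/card_leTTP[e ei] _] := muT.
have avoid a (f : nu -> nat -> T) : exists u : nat -> T,
    forall b, (b < a)%O -> eventually_all [set n | f b n <> u n].
  have /card_le_sigP/card_leTTP[i ii] := successor_segment a numu.
  (* The values to avoid at place [n] are indexed by a proper segment of the initial ordinal [mu],
     so they cannot exhaust [T]. *)
  have H n : exists t, forall b : {b | (b < a)%O}, (i b < c n)%O -> f (sval b) n <> t.
    apply: contrapT => nt; apply: (muc (c n)); apply/card_leTP.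
    have K t : exists2 b : {b | (b < a)%O}, (i b < c n)%O & f (sval b) n = t.
      apply: contrapT => nb; apply: nt; exists t => b bc e'; apply: nb; by exists b.
    have K' x : exists b : {b | (b < a)%O}, (i b < c n)%O /\ f (sval b) n = e x.
      by have [b ? ?] := K (e x); exists b.
    have [g gP] := choice K'; exists (i \o g) => [x y /ii xy|x]; last by case: (gP x).
    by apply: ei; rewrite -(proj2 (gP x)) xy (proj2 (gP y)).
  have [u uP] := choice H; exists u => b ba.
  by apply: eventually_mono (cP (i (exist _ b ba))) => n; exact: (uP n (exist _ b ba)).
have [||g gP] := @wf_choice nu (nat -> T) (fun x y => (x < y)%O)
    (fun f a u => forall b, (b < a)%O -> eventually_all [set n | f b n <> u n]) (fun=> e (c
      0)) (@wo_wf nu).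
- by move=> f g a u fg fu b ba; rewrite -fg //; exact: fu.
- by move=> f a _; exact: avoid.
exists g => a b; case: (ltgtP a b) => // ab _; first exact: gP.
by apply: eventually_mono (gP a b ab) => n /= ne e'; apply: ne.
Qed.

(** * Ordinal arithmetic inside an infinite cardinal *)

Section Segments.
Variable L : wellOrder.
Implicit Types (a b c l m x y z : L).

Lemma wo_least (S : set L) : (exists x, S x) ->
  exists x, S x /\ forall y, S y -> (x <= y)%O.
Proof.
move=> [x]; elim/(well_founded_ind (@wo_wf L)): x => x IH Sx.
have [[y yx Sy]|ny] := pselect (exists2 y, (y < x)%O & S y); first exact: IH Sy.
by exists x; split=> // y Sy; rewrite leNgt; apply/negP => yx; apply: ny; exists y.
Qed.

Hypothesis L_nomax : forall x, exists y, (x < y)%O.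
Hypothesis L_cardinal : is_cardinal L.

(** Write each element as [l] + [n] with [l] a limit and [n] finite, and send it with the bit [u] to
    [l] + 2[n] + [u]. Two copies of a segment thus fit into a proper segment. *)
Lemma pairing : exists phi : L -> bool -> L,
  (forall x y u v, phi x u = phi y v -> x = y /\ u = v) /\
  (forall a x u, (x < a)%O -> (phi x u < phi a false)%O).
Proof.
have [sc scP] := choice (fun x => wo_least (L_nomax x)).
have sc_lt x : (x < sc x)%O by case: (scP x).
have sc_le x y : (x < y)%O -> (sc x <= y)%O by move=> xy; case: (scP x) => _; apply.
have sc_inj : injective sc.
  move=> x y e; case: (ltgtP x y) => // /sc_le; [rewrite e|rewrite -e];
    by rewrite leNgt sc_lt.
(* The least element counts as a limit, so that [dec] reaches every [x]. *)
pose limit l := forall y, (y < l)%O -> (sc y < l)%O.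
have dec x : exists ln : L * nat, limit ln.1 /\ x = iter ln.2 sc ln.1.
  elim/(well_founded_ind (@wo_wf L)): x => x IH.
  have [xl|/existsNP[y /not_implyP[yx /negP]]] := pselect (limit x); first by exists (x, 0).
  rewrite -leNgt => xy; have [[l n] /= [ll yn]] := IH y yx.
  exists (l, n.+1); split=> //=; rewrite -yn; apply/le_anti/andP; split=> //.
  exact: sc_le.
have iter_lt l n x : limit l -> (x < l)%O -> (iter n sc x < l)%O.
  by move=> ll xl; elim: n => //= n; exact: ll.
have iter_inj l l' n n' : limit l -> limit l' -> iter n sc l = iter n' sc l' ->
    l = l' /\ n = n'.
  move=> ll ll'; elim: n n' => [|n IH] [|n'] //=.
  - move=> e; have := ll (iter n' sc l'); rewrite {1}e => /(_ (sc_lt _)).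
    by rewrite -e ltxx.
  - move=> e; have := ll' (iter n sc l); rewrite -{1}e => /(_ (sc_lt _)).
    by rewrite e ltxx.
  - by move=> /sc_inj/IH[-> ->].
have iter_mono x n n' : (n < n')%N -> (iter n sc x < iter n' sc x)%O.
  move=> nn; apply: (homo_ltn (r := fun x y : L => (x < y)%O) (f := fun n => iter n sc x)) nn.
    by move=> y x' z; exact: lt_trans.
  by move=> k /=.
have iter_le x n : (x <= iter n sc x)%O.
  by case: n => // n; exact: ltW (iter_mono x 0 n.+1 _).
have [d dP] := choice dec.
exists (fun x u => iter ((d x).2.*2 + u) sc (d x).1); split=> [x y u v|a x u xa].
  have [[lx ex] [ly ey]] := (dP x, dP y) => /(iter_inj _ _ _ _ lx ly)[el en].
  have uv : u = v by move/(congr1 odd): en; rewrite !oddD !odd_double; case: u; case: v.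
  split=> //; rewrite ex ey el; congr (iter _ _ _).
  by move: en; rewrite uv => /addIn/double_inj.
have [[lx ex] [la ea]] := (dP x, dP a).
have [l1|l1|l1] := ltgtP (d x).1 (d a).1.
- apply: lt_le_trans (iter_lt _ ((d x).2.*2 + u) _ la l1) _.
  exact: iter_le.
- have ax : (a < x)%O.
    rewrite ea; apply: lt_le_trans (iter_lt _ _ _ lx l1) _.
    by rewrite [leRHS]ex; exact: iter_le.
  by move: (lt_trans xa ax); rewrite ltxx.
- have xn : ((d x).2 < (d a).2)%N.
    rewrite ltnNge; apply/negP; rewrite leq_eqVlt => /orP[/eqP e|/(iter_mono (d a).1)].
      by move: xa; rewrite ex ea l1 e ltxx.
    by rewrite -{1}ea -l1 -ex => /(lt_trans xa); rewrite ltxx.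
  rewrite l1 addn0; apply: iter_mono.
  by case: u; rewrite ?addn1 ?addn0 -?doubleS ?ltn_Sdouble ?ltn_double // ?ltnS ?leq_double.
Qed.

(** If the two segments involved covered everything, [phi] would inject [L] into a proper segment,
    against [L] being an initial ordinal. *)
Lemma union_small (f : L -> L) a c : exists x, (a <= x)%O /\ forall b, (b < c)%O -> f b <> x.
Proof.
have [phi [phi_inj phi_bd]] := pairing.
apply: contrapT => nx; pose m := Order.max a c; apply: (L_cardinal (a := phi m false)).
have H x : exists y : L * bool, (y.1 < m)%O /\ x = if y.2 then f y.1 else y.1.
  have [xa|ax] := ltP x a.
    by exists (x, false); split=> //=; rewrite lt_max xa.
  have [[b bc fb]|nb] := pselect (exists2 b, (b < c)%O & f b = x).
    by exists (b, true); split=> //=; rewrite lt_max bc orbT.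
  by case: nx; exists x; split=> // b bc fb; apply: nb; exists b.
have [g gP] := choice H.
apply/card_leTP; exists (fun x => phi (g x).1 (g x).2) => [x y|x].
  by move=> /phi_inj[e1 e2]; rewrite (proj2 (gP x)) (proj2 (gP y)) e1 e2.
by apply: phi_bd; case: (gP x).
Qed.

(* Ordinal addition b |-> a + b. *)
Lemma shift a : exists S : L -> L, (forall b, (a <= S b)%O) /\
  (forall b b', (b < b')%O -> (S b < S b')%O).
Proof.
pose avoids (f : L -> L) b u := (a <= u)%O /\ forall b', (b' < b)%O -> f b' <> u.
have [||S SP] := @wf_choice L L (fun x y => (x < y)%O)
  (fun f b u => avoids f b u /\ forall v, avoids f b v -> (u <= v)%O) a (@wo_wf L).
- move=> f g b u fg [[au fu] umin]; split=> [|v [av gv]].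
    by split=> // b' bb; rewrite -fg //; exact: fu.
  by apply: umin; split=> // b' bb; rewrite fg //; exact: gv.
- move=> f b _; apply: wo_least; exact: union_small.
exists S; split=> [b|b b' bb]; first by case: (SP b) => -[].
(* The value at [b'] was already admissible at [b], where the least admissible one was taken. *)
have [[aS Sb'] _] := SP b'; have [_ Smin] := SP b.
rewrite lt_neqAle; apply/andP; split; first by apply/eqP; exact: Sb'.
by apply: Smin; split=> // c cb; apply: Sb'; exact: lt_trans bb.
Qed.

(** Two disjoint copies of the segment below [a], placed above [a] and bounded by [m]: room for a
    flag and a value at each [x < a]. *)
Lemma slots a : exists (sigma : L -> bool -> L) m,
  [/\ forall x y u v, sigma x u = sigma y v -> x = y /\ u = v,
      forall x u, (a <= sigma x u)%O & forall x u, (x < a)%O -> (sigma x u < m)%O].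
Proof.
have [phi [phi_inj phi_bd]] := pairing; have [S [aS Slt]] := shift a.
have S_inj : injective S.
  by move=> x y e; case: (ltgtP x y) => // /Slt; rewrite e ltxx.
exists (fun x u => S (phi x u)), (S (phi a false)); split=> // [x y u v /S_inj|x u xa].
  exact: phi_inj.
by apply: Slt; exact: phi_bd.
Qed.

End Segments.

(** * The collapse *)

Section TreeCode.
Variables L K : wellOrder.
Implicit Types (s t : tree L K) (a x y : L) (k : K).

Definition node_at s x k : Prop := exists xs : (x < projT1 s)%O, projT2 s (exist _ x xs) = k.

Lemma node_at_fun s x k k' : node_at s x k -> node_at s x k' -> k = k'.
Proof. by move=> [xs <-] [xs' <-]; rewrite (bool_irrelevance xs xs'). Qed.

Lemma node_at_le s t x k : (s <= t)%O -> node_at t x k -> node_at s x k.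
Proof.
move=> /asboolP[ts st] [xt <-]; have xs := lt_le_trans xt ts; exists xs; exact: st.
Qed.

Lemma node_at_ex s x : (x < projT1 s)%O -> exists k, node_at s x k.
Proof. by move=> xs; exists (projT2 s (exist _ x xs)), xs. Qed.

Hypothesis L_nomax : forall x, exists y, (x < y)%O.
Hypothesis L_cardinal : is_cardinal L.

(** [M a t s] says that [s] codes [t] in the slots above [a]: the flag slot of [x] holds [k1] or
    [k0] according to whether [x] is in the domain of [t], and the other slot holds the value there.
    A node [s] of height at most [a] leaves all slots free. *)
Lemma tree_code (k0 k1 : K) : k0 <> k1 -> exists M : L -> tree L K -> tree L K -> Prop,
  [/\ forall a t s s', (s' <= s)%O -> M a t s -> M a t s',
      forall a t t' s, (projT1 t <= a)%O -> (projT1 t' <= a)%O ->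
        M a t s -> M a t' s -> t = t' &
      forall a t s, (projT1 s <= a)%O -> exists2 s', (s' <= s)%O & M a t s'].
Proof.
move=> k01.
have [sg sgP] : exists sg : L -> (L -> bool -> L) * L, forall a,
    [/\ forall x y u v, (sg a).1 x u = (sg a).1 y v -> x = y /\ u = v,
      forall x u, (a <= (sg a).1 x u)%O & forall x u, (x < a)%O -> ((sg a).1 x u < (sg
        a).2)%O].
  have H a : exists r : (L -> bool -> L) * L,
    [/\ forall x y u v, r.1 x u = r.1 y v -> x = y /\ u = v,
      forall x u, (a <= r.1 x u)%O & forall x u, (x < a)%O -> (r.1 x u < r.2)%O].
    by have [sigma [m H]] := slots L_nomax L_cardinal a; exists (sigma, m).
  by have [f fP] := choice H; exists f.
exists (fun a t s => forall x, (x < a)%O ->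
  ((x < projT1 t)%O -> node_at s ((sg a).1 x true) k1 /\
     exists2 k, node_at t x k & node_at s ((sg a).1 x false) k) /\
  ((projT1 t <= x)%O -> node_at s ((sg a).1 x true) k0)); split.
- move=> a t s s' ss H x /H[H1 H2]; split=> [/H1[? [k ? ?]]|/H2].
    by split; [exact: node_at_le ss _|exists k => //; exact: node_at_le ss _].
  exact: node_at_le.
- have le a t t' s : (projT1 t <= a)%O -> (projT1 t' <= a)%O ->
      (forall x, (x < a)%O -> ((x < projT1 t)%O -> node_at s ((sg a).1 x true) k1 /\
         exists2 k, node_at t x k & node_at s ((sg a).1 x false) k) /\
         ((projT1 t <= x)%O -> node_at s ((sg a).1 x true) k0)) ->
      (forall x, (x < a)%O -> ((x < projT1 t')%O -> node_at s ((sg a).1 x true) k1 /\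
         exists2 k, node_at t' x k & node_at s ((sg a).1 x false) k) /\
         ((projT1 t' <= x)%O -> node_at s ((sg a).1 x true) k0)) -> (t <= t')%O.
    move=> ta ta' H H'; apply/asboolP; split=> [|x xt xt'].
      rewrite leNgt; apply/negP => tt'; have xa := lt_le_trans tt' ta'.
      have [/(_ tt')[H1 _] _] := H' _ xa; have [_ /(_ (lexx _)) H0] := H _ xa.
      by apply: k01; exact: node_at_fun H0 H1.
    have xa := lt_le_trans xt ta.
    have [/(_ xt)[_ [k tk sk]] _] := H x xa; have [/(_ xt')[_ [k' tk' sk']] _] := H' x xa.
    have -> : projT2 t (exist _ x xt) = k by apply: node_at_fun tk; exists xt.
    have -> : projT2 t' (exist _ x xt') = k' by apply: node_at_fun tk'; exists xt'.
    exact: node_at_fun sk sk'.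
  move=> a t t' s ta ta' H H'; apply/le_anti/andP.
  by split; [exact: le ta ta' H H'|exact: le ta' ta H' H].
- move=> a t s sa; have [sgi asg sgm] := sgP a; set sigma := (sg a).1 in sgi asg sgm *.
  (* The demands on the extension at [y]: to continue [s], to show the flag, to show the value. They
     never conflict, since [s] ends by [a] and distinct slots are disjoint. *)
  pose good y k := [/\ forall k', node_at s y k' -> k = k',
    forall x, y = sigma x true -> k = if (x < projT1 t)%O then k1 else k0 &
    forall x k', y = sigma x false -> node_at t x k' -> k = k'].
  have sN y x u k : node_at s y k -> y <> sigma x u.
    move=> [ys _] e; move: (lt_le_trans ys sa); rewrite e ltNge => /negP; apply; exact: asg.
  have ex y : exists k, good y k.
    have [[k sk]|ns] := pselect (exists k, node_at s y k).
      exists k; split=> [k'|x /(sN _ _ _ _ sk)//|x k' /(sN _ _ _ _ sk)//].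
      exact: node_at_fun sk.
    have {}ns k' : ~ node_at s y k' by move=> ?; apply: ns; exists k'.
    have [[x ->]|nx] := pselect (exists x, y = sigma x true).
      exists (if (x < projT1 t)%O then k1 else k0); split=> [k' sk'|z|z k' /sgi[]//].
        by exfalso; apply: (sN _ x true _ sk').
      by move=> /sgi[->].
    have [[x [k [yx tk]]]|nx'] := pselect (exists x k, y = sigma x false /\ node_at t x k).
      exists k; split=> [k' /ns//|z yz|z k' yz tk']; first by case: nx; exists z.
      by move: yz; rewrite yx => /sgi[e _]; apply: node_at_fun tk _; rewrite e.
    exists k0; split=> [k' /ns//|z yz|z k' yz tk']; first by case: nx; exists z.
    by case: nx'; exists z, k'.
  have [f fP] := choice ex.
  pose s' : tree L K := existT (fun a => {b : L | (b < a)%O} -> K)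
    (Order.max (projT1 s) (sg a).2) (fun v => f (sval v)).
  have s'f y : (y < projT1 s')%O -> node_at s' y (f y) by move=> ys; exists ys.
  exists s'.
    apply/asboolP; split=> [|y ys' ys]; first by rewrite /= le_max lexx.
    by have [H _ _] := fP y; apply: H; exists ys.
  move=> x xa; have sg' u : node_at s' (sigma x u) (f (sigma x u)).
    by apply: s'f; rewrite /= lt_max sgm ?orbT.
  have [_ ft _] := fP (sigma x true); have [_ _ ff] := fP (sigma x false).
  split=> xt.
    have := sg' true; rewrite (ft x erefl) xt; split=> //.
    have [k tk] := node_at_ex xt; exists k => //.
    by have := sg' false; rewrite (ff x k erefl tk).
  by have := sg' true; rewrite (ft x erefl) ltNge xt.
Qed.

End TreeCode.

Section Principal.
Context {d : Order.disp_t} {T : porderType d}.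

(** The image of a node in the completion: the regularisation of the cone below [t]. *)
Definition principal (t : T) : RO T :=
  MkRO (asboolT (perp_regular (@perp_down _ _ [set q : T | (q <= t)%O]))).

Lemma principal_self t : ro_set (principal t) t.
Proof. by apply: sub_perp2 => [p q qp|]; [exact: le_trans|exact: lexx]. Qed.

Lemma principal_dense t s : ro_set (principal t) s -> exists2 r, (r <= s)%O & (r <= t)%O.
Proof.
move=> /(_ s (lexx s)) H; apply: contrapT => nr; apply: H => r rs rt.
by apply: nr; exists r.
Qed.

Lemma principal_le t x : ro_set x t -> (principal t <= x)%O.
Proof.
move=> xt; apply/asboolP; rewrite -[ro_set x]roP.
by do 2 apply: perp_anti; move=> s st; exact: ro_down xt.
Qed.

Lemma ro_nonbot (x : RO T) : x != \bot%O <-> exists t, ro_set x t.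
Proof.
split=> [/eqP xb|[t xt]]; last first.
  by apply/eqP => xb; move: xt; rewrite xb.
apply: contrapT => nt; apply: xb; apply: ro_inj; apply/seteqP; split=> // t xt.
by case: nt; exists t.
Qed.

End Principal.

(** * The generic relation between h and nu *)

Section Main.
Variables lambda kappa mu nu h : wellOrder.
Hypotheses (lambda_cardinal : is_cardinal lambda) (kappa2 : [set: bool] #<= [set: kappa])
  (mu_card : is_cardinality_of mu (tree lambda kappa))
  (lambda_cof : has_cofinality lambda omega) (mu_cof : has_cofinality mu omega)
  (nu_succ : is_successor_cardinal nu mu) (h_is_h : is_h h).
Let T : porderType _ := tree lambda kappa.
Let P : porderType _ := pos (rp (Col lambda kappa)).

Lemma collapsing_relation : exists R : h -> nu -> set P,
  [/\ forall xi b, down_closed (R xi b),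
      forall xi b b' p, R xi b p -> R xi b' p -> b = b' &
      forall p b, exists2 q, (q <= p)%O & exists xi, R xi b q].
Proof.
have [k [ki]] : exists k : bool -> kappa, injective k /\ True.
  by have /card_leTTP[k ki] := kappa2; exists k.
have k01 : k false <> k true by move=> /ki.
have [l_nomax [l lP]] := cofinal_sequence lambda_cof.
have [M [Mle Minj Mex]] := tree_code l_nomax lambda_cardinal k01.
have [g gP] := eventually_different_family nu_succ mu_card mu_cof.
have [N [Ncoh Nex]] := h_names h_is_h.
pose sup (p : P) : set nat := [set i | exists t, ro_set (rep p i) t].
have supu (p : P) : unbounded (sup p).
  by apply: unbounded_mono (rep_unbounded p) => i /ro_nonbot.
have sup_le (p q : P) : (q <= p)%O -> almost_sub (sup q) (sup p).
  by move=> /rep_leP; apply: eventually_mono => i /asboolP qp [t /qp]; exists t.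
pose R xi be : set P := [set q | exists X f, [/\ N xi X f, almost_sub (sup q) X &
  eventually_all [set i | forall s, ro_set (rep q i) s -> (projT1 (g be i) <= l (f i))%O /\
    exists2 s', (s' <= s)%O & M (l (f i)) (g be i) s']]].
exists R; split.
- move=> xi be p q qp [X [f [NX pX H]]]; exists X, f; split=> //.
    exact: almost_sub_trans (sup_le _ _ qp) pX.
  move/rep_leP: qp => qp; apply: eventually_mono (eventually_and H qp).
  by move=> i [Hi /asboolP qpi] s /qpi; exact: Hi.
- move=> xi be be' p [X [f [NX pX H]]] [X' [f' [NX' pX' H']]].
  (* The support of [p] is infinite and almost contained in both [X] and [X'], so these meet
     infinitely often. *)
  have ff : f = f'.
    apply: Ncoh NX NX' _; have := unbounded_eventually (supu p) (eventually_and pX pX').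
    by apply: unbounded_mono => i [pi [Xi Xi']]; split; [exact: Xi|exact: Xi'].
  apply: contrapT => /gP ne.
  (* At a place of the support where the two nodes differ, coding one and then the other along a
     single branch at the same height contradicts [Minj]. *)
  have [i _ [pi [[Hi Hi'] nei]]] :=
    unbounded_eventually (supu p) (eventually_and (eventually_and H H') ne) 0.
  apply: nei; case: pi => s ps; have [gl [s1 s1s Ms1]] := Hi s ps.
  have [gl' [s2 s2s Ms2]] := Hi' s1 (ro_down s1s ps); rewrite -ff in gl' Ms2.
  exact: Minj gl gl' (Mle _ _ _ _ s2s Ms1) Ms2.
- move=> p be.
  (* A node inside [p] at place [i], with the index of a height above both this node and the node to
     be coded. These indices form the function to be guessed by some name. *)
  have Ht i : exists t : T * nat, sup p i ->
      [/\ ro_set (rep p i) t.1, (projT1 t.1 <= l t.2)%O & (projT1 (g be i) <= l t.2)%O].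
    have [[t pt]|np] := pselect (sup p i); last by exists (g be i, 0).
    have [n nP] := eventually_and (lP (projT1 t)) (lP (projT1 (g be i))).
    have [/ltW ? /ltW ?] := nP n (leqnn n); by exists (t, n).
  have [t tP] := choice Ht.
  have [xi [X [NX pX]]] := Nex (sup p) (fun i => (t i).2) (supu p).
  have Hs i : exists s : T, sup p i -> (s <= (t i).1)%O /\ M (l (t i).2) (g be i) s.
    have [pi|npi] := pselect (sup p i); last by exists (t i).1.
    by have [_ tl _] := tP i pi; have [s ? ?] := Mex _ (g be i) _ tl; exists s.
  have [s sP] := choice Hs.
  (* Bottom outside [X] makes the support of the new condition almost contained in [X], so that it
     decides the function. *)
  pose c i : RO T := if pselect (sup p i /\ X i) is left _ then principal (s i) else \bot%O.
  have cP i r : ro_set (c i) r -> [/\ sup p i, X i & c i = principal (s i)].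
    by rewrite /c; case: pselect => // -[].
  have [|q qc] := @rp_mk _ (Col lambda kappa) c.
    apply: unbounded_mono pX => i pXi /=; apply/ro_nonbot; exists (s i).
    rewrite /c; case: pselect => // _; exact: principal_self.
  exists q.
    apply/rep_leP; apply: eventually_mono qc => i /= ->; apply/asboolP => r cr.
    have [pi Xi ci] := cP i r cr; have [si _] := sP i pi; have [ti _ _] := tP i pi.
    have /asboolP := principal_le (ro_down si ti); apply; by rewrite -ci.
  exists xi, X, (fun i => (t i).2); split=> //.
    by apply: eventually_mono qc => i /= E; rewrite /sup /= E => -[r /cP[]].
  apply: eventually_mono qc => i /= -> r cr.
  have [pi Xi ci] := cP i r cr; have [_ Ms] := sP i pi; have [_ _ gl] := tP i pi.
  split=> //; rewrite ci in cr; have [s' s'r s's] := principal_dense cr.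
  by exists s' => //; exact: Mle s's Ms.
Qed.

Lemma successor_le_h : holds_in_extensions (le_cardF (check P nu) (check P h)).
Proof.
have [R [Rd Rf Rdense]] := collapsing_relation.
(* Forbidding smaller indices at every extension makes [q] decide that [xi] is least; injectivity
   comes from uniqueness of [be] in [R]. *)
pose F be xi : set P := [set q | R xi be q /\ forall eta r, (eta < xi)%O -> (r <= q)%O -> ~
  R eta be r].
move=> p.
apply: (@forced_injection_le _ P nu h _ _ (@check_elt_separated _ P nu)
  (@check_elt_separated _ P h) F).
split.
- move=> be xi q r rq [Rq Rmin]; split; first exact: Rd rq Rq.
  move=> eta s ex sr; exact: Rmin eta s ex (le_trans sr rq).
- move=> be xi eta q [Rq Rmin] [Rq' Rmin'].
  case: (ltgtP xi eta) => [lt_xi|lt_eta|//].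
    by have := Rmin' xi q lt_xi (lexx q) Rq.
  by have := Rmin eta q lt_eta (lexx q) Rq'.
- by move=> be be' xi q [Rq _] [Rq' _]; exact: Rf Rq Rq'.
- move=> be q qp; have [r0 r0q [xi0 Rr0]] := Rdense q be.
  have [xi [[r rq Rr] ximin]] := @wo_least h [set xi | exists2 r, (r <= q)%O & R xi be r]
    (ex_intro _ xi0 (ex_intro2 _ _ r0 r0q Rr0)).
  exists r => //; exists xi; split=> // eta s ex sr Rs.
  by have := ximin eta (ex_intro2 _ _ s (le_trans sr rq) Rs); rewrite leNgt ex.
Qed.

End Main.

Theorem theorem6p3 (lambda kappa mu nu h : wellOrder) :
  is_cardinal lambda -> is_cardinal kappa ->
  [set: omega] #<= [set: lambda] -> [set: bool] #<= [set: kappa] ->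
  card_lt omega (kappa * lambda) ->
  is_cardinality_of mu (tree lambda kappa) ->
  has_cofinality lambda omega -> has_cofinality mu omega ->
  is_successor_cardinal nu mu ->
  is_h h ->
  let P := pos (rp (Col lambda kappa)) in
  holds_in_extensions (le_cardF (check P nu) (check P h)) /\
  (holds_in_extensions (card_omega1 (check P h)) ->
   holds_in_extensions (card_omega1 (check P nu))).
Proof.
move=> lambda_card _ _ kappa2 _ mu_card lambda_cof mu_cof nu_succ hh P.
have nuh := successor_le_h lambda_card kappa2 mu_card lambda_cof mu_cof nu_succ hh.
split=> //; apply: collapse_to_omega1 nuh; first exact: rp_sigma_closed.
(* [nu] is uncountable: [mu] contains a copy of omega by its cofinality, so a countable [nu] would
   embed in [mu]. *)
have [_ [_ nu_mu] _] := nu_succ; move=> nu_nat; apply: nu_mu.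
apply: card_le_trans nu_nat _; have [[A _ /card_eqPle[_ Aomega]] _] := mu_cof.
exact: card_le_trans Aomega (card_leT _).
Qed.
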